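(* There is a well-defined $\mathbb{Z}$-linear map $\rho:\mathrm{WPQSym}\to\mathrm{PQSym}$ with $$\rho(K_\alpha)=\begin{cases}(-1)^j\,2^{\,2-\delta_{i,0}-\delta_{j,0}}\,K_{\alpha_0},&\text{if }\alpha=(0^i,\alpha_0,0^j)\text{ for some }i,j\in\mathbb{N}\text{ and a nonempty composition }\alpha_0,\\ \delta_{\alpha,\emptyset},&\text{otherwise},\end{cases}$$ for all weak compositions $\alpha$, and $\rho$ is a Hopf algebra projection from WPQSym onto PQSym (a surjective Hopf algebra homomorphism restricting to the identity on PQSym).
   Context: $\mathbb{N}=\{0,1,2,\dots\}$, $\mathbb{P}=\{1,2,\dots\}$. A weak composition is a finite (possibly empty) sequence of nonnegative integers; a composition is one with all entries positive. Every weak composition is uniquely $\alpha=(0^{i_1},s_1,\dots,0^{i_k},s_k,0^{i_{k+1}})$ with $i_p\in\mathbb{N}$, $s_q\in\mathbb{P}$ ($0^i$ = $i$ consecutive zeros); $\ell_0(\alpha)=\sum i_p$, $\|\alpha\|=\sum s_q+\ell_0(\alpha)$. $\mathbb{Z}[[x_1,x_2,\dots]]_{\mathbb{N}}$: formal power series whose monomials are finite products $\prod_{i\in I}x_i^{a_i}$ ($a_i\in\mathbb{N}$), where $x_i^0$ is a formal symbol distinct from $1$ and $x_i^ax_i^b=x_i^{a+b}$. For $\alpha=(a_1,\dots,a_r)$, $M_\alpha=\sum_{1\le i_1<\dots<i_r}x_{i_1}^{a_1}\cdots x_{i_r}^{a_r}$, $M_\emptyset=1$. WCQSym is the $\mathbb{Z}$-span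 of all $M_\alpha$, a Hopf algebra with $\Delta(M_\alpha)=\sum_{\beta\gamma=\alpha}M_\beta\otimes M_\gamma$ (sum over concatenation factorizations, empty pieces allowed) and $\varepsilon(M_\alpha)=\delta_{\alpha,\emptyset}$. QSym is the Hopf subalgebra spanned by $M_\alpha$ with $\alpha$ a composition. Enriched partitions: order $\mathbb{Z}\setminus\{0\}$ by $-1\prec1\prec-2\prec2\prec\cdots$. For a labeled poset (partial order $<_P$ on a finite $P\subset\mathbb{P}$), an enriched $P$-partition is $f:P\to\mathbb{Z}\setminus\{0\}$ with, for all $x<_Py$: $f(x)\preceq f(y)$; $f(x)=f(y)>0\Rightarrow x<y$; $f(x)=f(y)<0\Rightarrow x>y$. For $S\subseteq P$, $\Lambda(P,S)=\sum_f\prod_{v\in P}x_{|f(v)|}^{\delta_v}$, $\delta_v=1$ if $v\in S$, else $0$. $P_\alpha$ is the chain on $\{1,\dots,\|\alpha\|\}$ of shape $C_1\oplus P_1\oplus\cdots\oplus C_k\oplus P_k\oplus C_{k+1}$ with $|C_p|=i_p$, $|P_q|=s_q$, where $C_1,\dots,C_{k+1}$ (in order, increasing along the chain) get labels $1,\dots,\ell_0(\alpha)$ and then $P_k,P_{k-1},\dots,P_1$ (in order, increasing along the chain inside each block) get labels $\ell_0(\alpha)+1,\dots,\|\alpha\|$. $K_\alpha=\Lambda(P_\alpha,P_1\cup\dots\cup P_k)$, $K_\emptyset=1$. WPQSym is the $\mathbb{Z}$-span of all $K_\alpha$; it is a Hopf subalgebra of WCQSym. For compositions $\alpha$, $K_\alpha$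 are Stembridge's peak functions, and PQSym is the $\mathbb{Z}$-span of $\{K_\alpha:\alpha\text{ a composition}\}$, a Hopf subalgebra of QSym and of WPQSym. *)

(* Defs.v *)
From HB Require Import structures.
From mathcomp Require Import all_boot all_order all_algebra.
From mathcomp Require Import finmap boolp.

Set Implicit Arguments.
Unset Strict Implicit.
Unset Printing Implicit Defensive.

Import GRing.Theory.
Local Open Scope fset_scope.
Local Open Scope ring_scope.

(* A monomial \prod_(i in I) x_i ^ a_i is a finitely supported function sending
   i in I to Some a_i: the factor x_i ^ 0 (Some 0) differs from the absence of
   x_i (None). The index k : nat stands for the variable x_(k+1). *)
Definition mono := {fsfun nat -> option nat with None}.

Definition oadd (a b : option nat) : option nat :=
  match a, b with
  | None, _ => b
  | _, None => a
  | Some x, Some y => Some (x + y)%N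
  end.

Definition mmul (p q : mono) : mono :=
  [fsfun k in finsupp p `|` finsupp q => oadd (p k) (q k) | None].

Definition mone : mono := [fsfun].

Definition mvar (k a : nat) : mono := [fsfun k' in [fset k] => Some a | None].

(* The exponents of a monomial, read in increasing order of the variables. *)
Definition expts (m : mono) : seq nat := pmap m (sort leq (finsupp m)).

(* x_1 ^ a_1 * ... * x_r ^ a_r for the sequence (a_1, ..., a_r). *)
Definition std (al : seq nat) : mono :=
  [fsfun k in [fset k in iota 0 (size al)] => onth al k | None].

(* Families of integers indexed by T, for T := mono and T := mono * mono *)
Definition fam (T : Type) := T -> int.

Section FamZmod.
Variable T : Type.
HB.instance Definition _ := Choice.copy (fam T) (T -> int).

Let fadd (f g : fam T) : fam T := fun m => f m + g m.
Let fopp (f : fam T) : fam T := fun m => - f m.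
Let fzero : fam T := fun=> 0.

Let faddA : associative fadd.
Proof. by move=> f g h; apply: funext => m; rewrite /fadd addrA. Qed.
Let faddC : commutative fadd.
Proof. by move=> f g; apply: funext => m; rewrite /fadd addrC. Qed.
Let fadd0 : left_id fzero fadd.
Proof. by move=> f; apply: funext => m; rewrite /fadd add0r. Qed.
Let faddN : left_inverse fzero fopp fadd.
Proof. by move=> f; apply: funext => m; rewrite /fadd /fopp addNr. Qed.

HB.instance Definition _ := GRing.isZmodule.Build (fam T) faddA faddC fadd0 faddN.
End FamZmod.

(* Z[[x_1, x_2, ...]]_N, and the same with two sets of variables; the latter
   is where the tensor products live. *)
Definition pseries := fam mono.
Definition pseries2 := fam (mono * mono).
HB.instance Definition _ := GRing.Zmodule.on pseries.
HB.instance Definition _ := GRing.Zmodule.on pseries2.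

Lemma ps0E (m : mono) : (0 : pseries) m = 0. Proof. by []. Qed.
Lemma psDE (f g : pseries) m : (f + g) m = f m + g m. Proof. by []. Qed.
Lemma psNE (f : pseries) m : (- f) m = - f m. Proof. by []. Qed.

(* Every factor of m belongs to the finite list facs m. *)
Definition box_mono (m : mono)
    (b : {ffun finsupp m -> option 'I_(\max_(i : finsupp m) odflt 0 (m (val i))).+1}) : mono :=
  [fsfun i : finsupp m => omap val (b i) | None].

Definition facs (m : mono) : seq mono := [seq @box_mono m b | b in predT].

Definition pmul (f g : pseries) : pseries :=
  fun m => \sum_(p <- facs m) \sum_(q <- facs m | mmul p q == m) f p * g q.

Definition pone : pseries := fun m => (m == mone)%:R.

Lemma mmulE p q k : mmul p q k = oadd (p k) (q k).
Proof.
rewrite fsfunE inE !mem_finsupp.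
by case: (p k) (q k) => [a|] [b|].
Qed.

Lemma oaddA : associative oadd.
Proof. by case=> [a|] [b|] [c|] //=; rewrite addnA. Qed.
Lemma oaddC : commutative oadd.
Proof. by case=> [a|] [b|] //=; rewrite addnC. Qed.
Lemma mmulA : associative mmul.
Proof. by move=> p q r; apply/fsfunP => k; rewrite !mmulE oaddA. Qed.
Lemma mmulC : commutative mmul.
Proof. by move=> p q; apply/fsfunP => k; rewrite !mmulE oaddC. Qed.
Lemma moneE k : mone k = None.
Proof. by rewrite fsfunE. Qed.
Lemma mmul1 : left_id mone mmul.
Proof. by move=> p; apply/fsfunP => k; rewrite !mmulE moneE. Qed.


HB.instance Definition _ := Monoid.isComLaw.Build mono mone mmul mmulA mmulC mmul1.

Lemma box_monoE m b (i : finsupp m) : @box_mono m b (val i) = omap val (b i).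
Proof. by rewrite fsfun_ffun valK. Qed.

Lemma box_mono_inj m : injective (@box_mono m).
Proof.
move=> b c /fsfunP E; apply/ffunP => i; have := E (val i); rewrite !box_monoE.
by case: (b i) (c i) => [x|] [y|] //= [/val_inj ->].
Qed.

Lemma uniq_facs m : uniq (facs m).
Proof. by rewrite map_inj_uniq ?enum_uniq //; apply: box_mono_inj. Qed.

Lemma facs_factor m p q : mmul p q = m -> p \in facs m.
Proof.
move=> E; have hk k a : p k = Some a -> exists2 c, m k = Some c & (a <= c)%N.
  rewrite -E mmulE => ->; case: (q k) => [b|] /=; last by exists a.
  by exists (a + b)%N; rewrite ?leq_addr.
apply/mapP; exists [ffun i : finsupp m => omap inord (p (val i))].
  by rewrite mem_enum.
apply/fsfunP => k; case: (boolP (k \in finsupp m)) => km.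
  have -> : k = val [` km]%fset by [].
  rewrite box_monoE ffunE; case Ep: (p _) => [a|] //=.
  have [c Ec ac] := hk _ _ Ep; rewrite inordK // ltnS (leq_trans ac) //.
  have -> : c = odflt 0 (m (val [` km]%fset)) by rewrite Ec.
  exact: (leq_bigmax [` km]%fset).
rewrite fsfun_ffun insubF ?(negbTE km) //=.
case Ep: (p k) => [a|] //; have [c Ec _] := hk _ _ Ep.
by move: km; rewrite mem_finsupp Ec.
Qed.

Lemma pmulE (X : seq mono) (f g : pseries) m : uniq X ->
  (forall p q, mmul p q = m -> p \in X) ->
  pmul f g m = \sum_(p <- X) \sum_(q <- X | mmul p q == m) f p * g q.
Proof.
move=> uX hX; rewrite /pmul.
have aux (Y Z : seq mono) (F : mono -> int) (P : pred mono) : uniq Y -> uniq Z ->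
    (forall p, P p -> p \in Y) -> (forall p, P p -> p \in Z) ->
    \sum_(p <- Y | P p) F p = \sum_(p <- Z | P p) F p.
  move=> uY uZ hY hZ; rewrite -[LHS]big_filter -[RHS]big_filter.
  apply: perm_big; apply: uniq_perm; rewrite ?filter_uniq // => p.
  by rewrite !mem_filter; case Pp: (P p) => //=; rewrite hY ?hZ.
have hF p q : mmul p q == m -> p \in facs m by move=> /eqP; apply: facs_factor.
have hX' p q : mmul p q == m -> p \in X by move=> /eqP; apply: hX.
transitivity (\sum_(p <- facs m) \sum_(q <- X | mmul p q == m) f p * g q).
  apply: eq_bigr => p _; apply: aux => // [|q|q]; rewrite ?uniq_facs // mmulC.
    exact: hF.
  exact: hX'.
pose P p := has (fun q => mmul p q == m) X.
rewrite (bigID P) [RHS](bigID P) /= [X in _ + X]big1 ?[X in _ = _ + X]big1.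
- congr (_ + 0); apply: aux => // [|p /hasP[q _]|p /hasP[q _]].
  + exact: uniq_facs.
  + exact: hF.
  + exact: hX'.
- by move=> p /hasPn nP; rewrite big_seq_cond big1 // => q /andP[/nP /negbTE->].
- by move=> p /hasPn nP; rewrite big_seq_cond big1 // => q /andP[/nP /negbTE->].
Qed.

Lemma pmulC : commutative pmul.
Proof.
move=> f g; apply: funext => m; rewrite /pmul.
under eq_bigr do rewrite big_mkcond; rewrite exchange_big /=.
apply: eq_bigr => p _; rewrite [RHS]big_mkcond; apply: eq_bigr => q _.
by rewrite mmulC mulrC.
Qed.

Lemma pmul1 : left_id pone pmul.
Proof.
move=> f; apply: funext => m.
have m1 : mone \in facs m by apply: (@facs_factor _ _ m); rewrite mmul1.
have mm : m \in facs m by apply: (@facs_factor _ _ mone); rewrite mmulC mmul1.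
rewrite /pmul (bigD1_seq mone) ?uniq_facs //= [X in _ + X]big1 ?addr0; last first.
  by move=> p /negbTE pn; rewrite big1 // => q _; rewrite /pone pn mul0r.
under eq_bigl do rewrite mmul1.
rewrite -big_filter (@filter_pred1_uniq _ _ m) ?uniq_facs // big_seq1.
by rewrite /pone eqxx mul1r.
Qed.

Lemma pmul_def f g m :
  pmul f g m = \sum_(p <- facs m) \sum_(q <- facs m | mmul p q == m) f p * g q.
Proof. by []. Qed.

Lemma pmulDl : left_distributive pmul +%R.
Proof.
move=> f g h; apply: funext => m; rewrite psDE /pmul -big_split /=.
apply: eq_bigr => p _; rewrite -big_split /=.
by apply: eq_bigr => q _; rewrite psDE mulrDl.
Qed.

Lemma pmulA : associative pmul.
Proof.
move=> f g h; apply: funext => m.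
set X := facs m.
have uX : uniq X := uniq_facs m.
have hX p q : mmul p q = m -> p \in X by apply: facs_factor.
have sub k p q r : mmul k r = m -> mmul p q = k -> p \in X.
  by move=> km pk; apply: (hX _ (mmul q r)); rewrite mmulA pk.
pose T p q r := if mmul p (mmul q r) == m then f p * g q * h r else 0.
have inner (u v : pseries) k r :
    mmul k r = m -> pmul u v k = \sum_(p <- X) \sum_(q <- X | mmul p q == k) u p * v q.
  by move=> km; apply: pmulE => // p q; apply: sub km.
transitivity (\sum_(p <- X) \sum_(q <- X) \sum_(r <- X) T p q r).
  rewrite [LHS]pmul_def -/X; apply: eq_bigr => p _.
  transitivity (\sum_(k <- X) \sum_(q <- X) \sum_(r <- X)
      if (mmul q r == k) && (mmul p k == m) then f p * g q * h r else 0).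
    rewrite big_mkcond; apply: eq_bigr => k _; case: eqP => [pk|_]; last first.
      by rewrite big1 // => q _; rewrite big1 // => r _; rewrite andbF.
    rewrite (inner _ _ _ p) ?(mmulC k) // mulr_sumr; apply: eq_bigr => q _.
    rewrite big_mkcond mulr_sumr; apply: eq_bigr => r _; rewrite andbT.
    by case: eqP => _; rewrite ?mulr0 // mulrA.
  rewrite exchange_big; apply: eq_bigr => q _; rewrite exchange_big.
  apply: eq_bigr => r _ /=; rewrite /T; case: eqP => [E|E]; last first.
    by rewrite big1 // => k _; case: eqP => //= <-; case: eqP.
  have kX : mmul q r \in X by apply: (hX _ p); rewrite mmulC.
  rewrite (bigD1_seq (mmul q r)) //= eqxx E eqxx big1 ?addr0 // => k.
  by rewrite eq_sym => /negbTE ->.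
rewrite [RHS]pmul_def -/X.
transitivity (\sum_(k <- X) \sum_(r <- X) \sum_(p <- X) \sum_(q <- X)
    if (mmul p q == k) && (mmul k r == m) then f p * g q * h r else 0); last first.
  apply: eq_bigr => k _; rewrite [RHS]big_mkcond; apply: eq_bigr => r _.
  case: eqP => [kr|_]; last first.
    by rewrite big1 // => p _; rewrite big1 // => q _; rewrite andbF.
  rewrite (inner _ _ _ r) // mulr_suml; apply: eq_bigr => p _.
  rewrite [X in X * _]big_mkcond mulr_suml; apply: eq_bigr => q _; rewrite andbT.
  by case: eqP; rewrite ?mul0r.
transitivity (\sum_(r <- X) \sum_(p <- X) \sum_(q <- X) T p q r).
  rewrite [RHS]exchange_big; apply: eq_bigr => p _; exact: exchange_big.
rewrite [RHS]exchange_big; apply: eq_bigr => r _ /=.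
rewrite [RHS]exchange_big; apply: eq_bigr => p _ /=.
rewrite [RHS]exchange_big; apply: eq_bigr => q _ /=; rewrite /T mmulA.
case: eqP => [E|E]; last first.
  by rewrite [RHS]big1 // => k _; case: eqP => //= <-; case: eqP.
rewrite (bigD1_seq (mmul p q)) //=; last exact: hX E.
rewrite eqxx E eqxx [X in _ + X]big1 ?addr0 // => k.
by rewrite eq_sym => /negbTE ->.
Qed.

Lemma pone_neq0 : pone != 0.
Proof. by apply/eqP => /(congr1 (fun f : pseries => f mone)); rewrite /pone eqxx. Qed.

HB.instance Definition _ :=
  GRing.Zmodule_isComNzRing.Build pseries pmulA pmulC pmul1 pmulDl pone_neq0.

Definition tens (f g : pseries) : pseries2 := fun pq => f pq.1 * g pq.2.

(* The monomials x_(i_1) ^ a_1 * ... * x_(i_r) ^ a_r with i_1 < ... < i_r are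
   pairwise distinct, and are those with exponent sequence (a_1, ..., a_r). *)
Definition M (al : seq nat) : pseries := fun m => (expts m == al)%:R.

(* On the span of the M_al, the coefficient of M_al in f is f (std al); these
   are thus the linear maps with the values on M_al given by Delta_M, counit_M. *)
Definition Delta (f : pseries) : pseries2 :=
  fun pq => f (std (expts pq.1 ++ expts pq.2)).

Definition counit (f : pseries) : int := f mone.

Lemma stdE al k : std al k = onth al k.
Proof.
rewrite fsfunE inE /= mem_iota add0n /=; case: ltnP => // h.
by rewrite /= onth_default.
Qed.

Lemma expts_std al : expts (std al) = al.
Proof.
rewrite /expts; have -> : sort leq (finsupp (std al)) = iota 0 (size al).
  apply: (sorted_eq leq_trans anti_leq).
  - exact: (sort_sorted leq_total).
  - exact: iota_sorted.
  apply: uniq_perm; rewrite ?sort_uniq ?iota_uniq ?fset_uniq // => k.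
  rewrite mem_sort mem_finsupp stdE mem_iota add0n /=.
  by elim: al k => [|a al IH] [|k] //=; rewrite ?ltnS.
rewrite (eq_pmap (stdE al)); elim: al => //= a al IH.
rewrite (iotaDl 1 0); congr (_ :: _); rewrite -[RHS]IH.
by elim: (iota 0 _) => //= k s <-.
Qed.

Lemma expts_eq0 m : (expts m == [::]) = (m == mone).
Proof.
apply/eqP/eqP => [E|->]; last first.
  by rewrite /expts /mone finsupp0.
apply/fsfunP => k; rewrite moneE; case Ek: (m k) => [a|] //.
suff : a \in expts m by rewrite E.
rewrite mem_pmap; apply/mapP; exists k; rewrite ?Ek //.
by rewrite mem_sort mem_finsupp Ek.
Qed.

Lemma M_nil : M [::] = 1.
Proof. by apply: funext => m; rewrite /M expts_eq0. Qed.

Lemma Delta_M al :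
  Delta (M al) = \sum_(k < (size al).+1) tens (M (take k al)) (M (drop k al)).
Proof.
have sumE (I : finType) (F : I -> pseries2) pq : (\sum_i F i) pq = \sum_i F i pq.
  by apply: (big_morph (fun f : pseries2 => f pq)).
apply: funext => -[p q]; rewrite sumE /Delta /M /tens expts_std /=.
set b := expts p; set c := expts q.
case: eqP => [E|nE].
  have hb : (size b < (size al).+1)%N by rewrite -E size_cat ltnS leq_addr.
  rewrite (bigD1 (Ordinal hb)) //= big1 ?addr0 => [|k].
    by rewrite -E take_size_cat // drop_size_cat // !eqxx.
  rewrite -val_eqE /= => kb; case: (b =P take k al) => [Eb|]; last by rewrite mul0r.
  by move: kb; rewrite Eb size_takel ?eqxx // -ltnS.
rewrite big1 // => k _; case: (b =P take k al) => [Eb|]; last by rewrite mul0r.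
case: (c =P drop k al) => [Ec|]; last by rewrite mulr0.
by case: nE; rewrite Eb Ec cat_take_drop.
Qed.

Lemma counit_M al : counit (M al) = (al == [::])%:R.
Proof.
rewrite /counit /M; have /eqP -> : expts mone == [::] by rewrite expts_eq0.
by rewrite eq_sym.
Qed.

(* -1 < 1 < -2 < 2 < ... *)
Definition preceq (x y : int) : bool :=
  (`|x| < `|y|)%N || ((`|x| == `|y|)%N && (x <= y)).

Section Enriched.
Variables (P : {fset nat}) (ltP : rel nat).

Definition enriched (f : P -> int) : bool :=
  [forall x : P, forall y : P, ltP (val x) (val y) ==>
    [&& preceq (f x) (f y),
        ((f x == f y) && (0 < f x)) ==> (val x < val y)%N
      & ((f x == f y) && (f x < 0)) ==> (val x > val y)%N]].

Definition weight (S : {fset nat}) (f : P -> int) : mono :=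
  \big[mmul/mone]_(v : P) mvar (`|f v|%N).-1 (val v \in S).

(* +(k+1) or -(k+1) *)
Definition signed (u : nat * bool) : int := if u.2 then u.1.+1%:Z else - u.1.+1%:Z.

(* The coefficient of m is the number of enriched P-partitions f of weight m;
   the variable x_|f v| of such an f occurs in m for all v in P. *)
Definition Lambda (S : {fset nat}) : pseries := fun m =>
  #|[set f : {ffun P -> finsupp m * bool} |
      let f' v := signed (val (f v).1, (f v).2) in
      enriched f' && (weight S f' == m)]|%:R.
End Enriched.

Definition composition (al : seq nat) : bool := 0%N \notin al.

(* The labels of P_al listed along the chain: c is the next label of a zero, and
   the s labels of an entry s > 0 come after those of the entries to its right. *)
Fixpoint chain_from (l0 c : nat) (al : seq nat) : seq nat :=
  match al with
  | [::] => [::]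
  | 0%N :: be => c :: chain_from l0 c.+1 be
  | s :: be => iota (l0 + sumn be).+1 s ++ chain_from l0 c be
  end.

Definition ell0 (al : seq nat) : nat := count_mem 0%N al.
Definition chain (al : seq nat) : seq nat := chain_from (ell0 al) 1 al.

Definition K (al : seq nat) : pseries :=
  @Lambda [fset x in chain al]%fset
    (fun x y => (index x (chain al) < index y (chain al))%N)
    [fset x in chain al | (ell0 al < x)%N]%fset.

Definition zspan (D : {pred seq nat}) (F : seq nat -> pseries) : {pred pseries} :=
  [pred f | `[< exists2 s : seq (int * seq nat), all (fun c => c.2 \in D) s
              & f = \sum_(c <- s) F c.2 *~ c.1 >]].

Definition WCQSym := zspan predT M.
Definition WPQSym := zspan predT K.
Definition PQSym := zspan composition K.

Definition zlinear_on (A B : {pred pseries}) (r : pseries -> pseries) : Prop :=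
  {in A, forall f, r f \in B} /\
  forall c : int, {in A &, forall f g, r (f *~ c + g) = r f *~ c + r g}.

(* The graph of r \otimes r on A \otimes A. The submodules of the torsion-free
   module pseries used here are free, so that f \otimes g |-> tens f g embeds
   A \otimes A into pseries2. *)
Definition tens_graph (A : {pred pseries}) (r : pseries -> pseries) (t u : pseries2) : Prop :=
  exists s : seq (pseries * pseries),
    [/\ all (fun fg => (fg.1 \in A) && (fg.2 \in A)) s,
        t = \sum_(fg <- s) tens fg.1 fg.2
      & u = \sum_(fg <- s) tens (r fg.1) (r fg.2)].

(* The antipode of WCQSym, the convolution inverse of the identity; it restricts
   to the antipodes of the Hopf subalgebras. *)
Definition is_antipode (S : pseries -> pseries) : Prop :=
  zlinear_on WCQSym WCQSym S /\
  forall al,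
    \sum_(k < (size al).+1) S (M (take k al)) * M (drop k al)
      = (counit (M al))%:~R /\
    \sum_(k < (size al).+1) M (take k al) * S (M (drop k al))
      = (counit (M al))%:~R.

(* Meant for Hopf subalgebras A and B of WCQSym: the structure maps are those of
   WCQSym, under which A and B are stable. *)
Record hopf_morphism (A B : {pred pseries}) (r : pseries -> pseries) : Prop := HopfMorphism {
  hopf_linear : zlinear_on A B r;
  hopf_unit : r 1 = 1;
  hopf_mul : {in A &, {morph r : f g / f * g}};
  hopf_counit : {in A, forall f, counit (r f) = counit f};
  hopf_Delta : {in A, forall f, tens_graph A r (Delta f) (Delta (r f))};
  hopf_antipode : forall S, is_antipode S -> {in A, forall f, r (S f) = S (r f)}
}.

Record hopf_projection (A B : {pred pseries}) (r : pseries -> pseries) : Prop := HopfProjection {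
  projection_morphism : hopf_morphism A B r;
  projection_surj : {in B, forall g, exists2 f, f \in A & r f = g};
  projection_id : {in B, forall g, r g = g}
}.

(* Main.v *)
(** Along the chain of a weak composition an enriched partition assigns to each
    |value| a factor of the chain that descends (negative values) and then ascends
    (positive values). With * the convolution of functions on words, every variable
    thus contributes E * H, where E and H test for descents and for ascents; since
    the zeros have the small labels, E * H = E1 * Z * H1 with E1, H1 carried by words
    of ones and Z by words of zeros.

    Substitute for each variable x a block of 4M + 2 signed multiples of x: first
    0 x, then x, -x, x, ..., x (2M + 1 terms), then 0 x (2M times). Here 0 x keeps
    the monomials x ^ 0 and kills the others, so that it contributes Z, while -x
    contributes H1^-1 * Z * E1^-1 (convolution inverses). The block collapses to
    Z * (E1 * Z^(2M+1) * H1) * Z^(2M), and each coefficient of the image of K_alpha is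
    a polynomial in 2M + 1, whose value at 2M + 1 = 0 is given by
    Z * (E1 * H1) * Z^-1; this is rho (K_alpha). Being a value of a polynomial family
    of ring morphisms, rho is well defined and multiplicative, and conjugation by Z
    is compatible with deconcatenation. *)

From HB Require Import structures.
Require Import Defs.
From mathcomp Require Import all_boot all_order all_algebra.
From mathcomp Require Import finmap boolp ring zify.

Set Implicit Arguments.
Unset Strict Implicit.
Unset Printing Implicit Defensive.

Import GRing.Theory.
Local Open Scope ring_scope.

(** * Convolution of functions on words *)

(** Relations among the K_alpha are never analysed: the substitution acts on all series, so every
    relation passes to the images. The obstacle is the factor Z^-1. It carries the sign (-1)^j of
    the statement, but no signed multiple of a variable can produce it, since rescaling x leaves x ^
    0 and hence Z unchanged. Only nonnegative powers of Z are available, and the negative one has to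
    be reached by interpolation. This dictates the block. In x, -x, x, ... the facing runs of ones
    cancel while the factors Z pile up, which leaves Z^(2M+1) between E1 and H1; exponent 0 removes
    it. The trailing terms give Z^(2M) = Z^(2M+1) * Z^-1, which becomes Z^-1 at exponent 0, and the
    leading term supplies the Z that makes the result a conjugate. Conjugates telescope in products,
    so the several variables of a monomial leave one Z in front and one Z^-1 behind. On the word of
    n > 0 consecutive zeros of a chain, Z takes the value 2 and Z^-1 the value (-1)^n * 2, whence
    the powers of 2 and the sign. *)

(* A letter stands for an element of a labeled chain: whether it is weighted (in S),
   and whether its label is larger than that of the next element. *)
Definition letter := (bool * bool)%type.
Definition word := seq letter.
Definition deg (w : word) : nat := count fst w.

Fixpoint conv (R : comNzRingType) (f g : word -> R) (w : word) : R :=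
  if w is x :: w' then f [::] * g w + conv (fun u => f (x :: u)) g w'
  else f [::] * g [::].

Definition wfun (R : comNzRingType) := word -> R.

Section WordFunctionals.
Variable R : comNzRingType.
Implicit Types (f g h : wfun R) (w : word).

Lemma convE f g w :
  conv f g w = \sum_(k < (size w).+1) f (take k w) * g (drop k w).
Proof.
elim: w f => [|x w IH] f /=; first by rewrite big_ord1.
by rewrite big_ord_recl /= IH.
Qed.

HB.instance Definition _ := Choice.copy (wfun R) (word -> R).

Let wadd f g : wfun R := fun w => f w + g w.
Let wopp f : wfun R := fun w => - f w.
Let wzero : wfun R := fun=> 0.
Let waddA : associative wadd.
Proof. by move=> f g h; apply: funext => w; rewrite /wadd addrA. Qed.
Let waddC : commutative wadd.
Proof. by move=> f g; apply: funext => w; rewrite /wadd addrC. Qed.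
Let wadd0 : left_id wzero wadd.
Proof. by move=> f; apply: funext => w; rewrite /wadd add0r. Qed.
Let waddN : left_inverse wzero wopp wadd.
Proof. by move=> f; apply: funext => w; rewrite /wadd addNr. Qed.
HB.instance Definition _ := GRing.isZmodule.Build (wfun R) waddA waddC wadd0 waddN.

Lemma wfunD f g w : (f + g) w = f w + g w. Proof. by []. Qed.

Let wone : wfun R := fun w => (w == [::])%:R.
Let wmul f g : wfun R := conv f g.

Lemma convDl f1 f2 g w :
  conv (fun u => f1 u + f2 u) g w = conv f1 g w + conv f2 g w.
Proof. by rewrite !convE -big_split; apply: eq_bigr => k _; rewrite mulrDl. Qed.

Lemma convZl (a : R) f g w : conv (fun u => a * f u) g w = a * conv f g w.
Proof. by rewrite !convE mulr_sumr; apply: eq_bigr => k _; rewrite mulrA. Qed.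

Let wmulA : associative wmul.
Proof.
move=> f g h; apply: funext => w; rewrite /wmul.
elim: w f g => [|x w IH] f g /=; first by rewrite mulrA.
rewrite (convDl (fun u => f [::] * g (x :: u))).
by rewrite (convZl (f [::]) (fun u => g (x :: u))) -IH mulrDr mulrA addrA.
Qed.
Let wmul1 : left_id wone wmul.
Proof.
move=> f; apply: funext => w; rewrite /wmul convE big_ord_recl take0 drop0.
rewrite mul1r big1 ?addr0 // => k _; case: w k => [|x w] k; first by case: k.
by rewrite /wone mul0r.
Qed.
Let wmulr1 : right_id wone wmul.
Proof.
move=> f; apply: funext => w; rewrite /wmul convE big_ord_recr take_size drop_size.
rewrite big1 => [|k _] /=; first by rewrite /wone /= add0r mulr1.
rewrite /wone -size_eq0 size_drop subn_eq0.
by rewrite leqNgt ltn_ord mulr0.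
Qed.
Let wmulDl : left_distributive wmul +%R.
Proof. by move=> f g h; apply: funext => w; rewrite /wmul convDl. Qed.
Let wmulDr : right_distributive wmul +%R.
Proof.
move=> f g h; apply: funext => w; rewrite wfunD /wmul !convE -big_split.
by apply: eq_bigr => k _; rewrite mulrDr.
Qed.
Let wone_neq0 : wone != 0.
Proof.
by apply/eqP => /(congr1 (fun f => f [::])) /eqP; rewrite /wone oner_eq0.
Qed.
HB.instance Definition _ :=
  GRing.Zmodule_isNzRing.Build (wfun R) wmulA wmul1 wmulr1 wmulDl wmulDr wone_neq0.

Lemma wfunM f g w :
  (f * g) w = \sum_(k < (size w).+1) f (take k w) * g (drop k w).
Proof. exact: convE. Qed.

Definition wder x f : wfun R := fun u => f (x :: u).

Lemma wfunM_cons f g x w :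
  (f * g) (x :: w) = f [::] * g (x :: w) + (wder x f * g) w.
Proof. by []. Qed.

Lemma wfunM_nil f g : (f * g) [::] = f [::] * g [::].
Proof. by []. Qed.

Lemma wfun1 w : (1 : wfun R) w = (w == [::])%:R.
Proof. by []. Qed.

Lemma wfun_sum I (r : seq I) (P : pred I) (F : I -> wfun R) w :
  (\sum_(i <- r | P i) F i) w = \sum_(i <- r | P i) F i w.
Proof. exact: (big_morph (fun f : wfun R => f w)). Qed.

Lemma wfunMn f n w : (f *+ n) w = f w *+ n.
Proof. by elim: n => // n IH; rewrite !mulrS wfunD IH. Qed.

End WordFunctionals.

(** For multiplicative [g] this is a ring endomorphism. Length signs, rescaling a variable and
    recording its power are all of this form. *)
Definition twist (R : comNzRingType) (g : word -> R) (f : wfun R) : wfun R :=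
  fun w => g w * f w.

Section Twist.
Variables (R : comNzRingType) (g : word -> R).
Hypotheses (g0 : g [::] = 1) (gM : forall u v, g (u ++ v) = g u * g v).

Lemma twist1 : twist g 1 = 1.
Proof.
apply: funext => w; rewrite /twist wfun1.
by case: eqP => [->|_]; rewrite ?g0 ?mulr0 ?mulr1.
Qed.

Lemma twistM f1 f2 : twist g (f1 * f2) = twist g f1 * twist g f2.
Proof.
apply: funext => w; rewrite /twist !wfunM mulr_sumr; apply: eq_bigr => k _.
by rewrite -{1}(cat_take_drop k w) gM mulrACA.
Qed.

End Twist.

(** * Runs *)

(* The last flag of a factor refers to a letter outside of it and is ignored. *)
Fixpoint isrun (b d : bool) (w : word) : bool :=
  if w is x :: w' then [&& x.1 == b, (w' == [::]) || (x.2 == d) & isrun b d w']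
  else true.

Definition run (b d : bool) : wfun int := fun w => (isrun b d w)%:R.

Definition sgns (w : word) : int := (-1) ^+ size w.
Definition size_twist : wfun int -> wfun int := twist sgns.

Lemma sgns_cat u v : sgns (u ++ v) = sgns u * sgns v.
Proof. by rewrite /sgns size_cat exprD. Qed.

Lemma size_twistM f g : size_twist (f * g) = size_twist f * size_twist g.
Proof. exact: (twistM sgns_cat). Qed.

Lemma size_twistK : involutive size_twist.
Proof.
by move=> f; apply: funext => w; rewrite /size_twist /twist mulrA -expr2 sqrr_sign mul1r.
Qed.

Lemma size_twist1 : size_twist 1 = 1.
Proof. exact: twist1. Qed.

Definition wscale (R : comNzRingType) (a : R) (f : wfun R) : wfun R := fun w => a * f w.

Lemma wscaleE (R : comNzRingType) (a : R) f w : wscale a f w = a * f w.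
Proof. by []. Qed.

Lemma wscaleAl (R : comNzRingType) (a : R) f g : wscale a f * g = wscale a (f * g).
Proof. by apply: funext => w; exact: convZl. Qed.

Lemma wder_run b d x : wder x (run b d) =
  wscale (x.1 == b)%:R (wscale (x.2 == d)%:R (run b d) + wscale (x.2 != d)%:R 1).
Proof.
apply: funext => u; rewrite /wder wscaleE wfunD !wscaleE wfun1 /run /=.
case: u => [|y u] /=; case: (x.1 == b); case: (x.2 == d) => /=;
  by rewrite ?(mul0r, mul1r, mulr0, addr0, add0r).
Qed.

(* Only the two cuts around the first break of a run survive, with opposite signs. *)
Lemma runV b d : run b d * size_twist (run b (~~ d)) = 1.
Proof.
apply: funext => w; rewrite wfun1; elim: w => [|x w IH]; first by [].
rewrite wfunM_cons wder_run !(wscaleAl, mulrDl) !(wscaleE, wfunD) IH (mul1r (size_twist _)).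
rewrite /size_twist /twist /run /sgns /=; case: (x.1 == b) => /=; last first.
  by rewrite !mul0r !mulr0 !addr0.
case: eqP => [->|_] /=; first by rewrite !mulr1 !mul1r /=; case: (x.2 == d).
move=> {IH}; case: x => _ [] /=; case: d => /=;
  rewrite ?(mul0r, mulr0, mul1r, addr0, add0r, mulr1) // exprS mulN1r mulNr addNr //.
Qed.

Definition zeros_fun : wfun int := run false true * run false false.
Definition chain_fun : wfun int := run true true * zeros_fun * run true false.

(* The effect of multiplying a variable by s. *)
Definition spec (s : int) : wfun int -> wfun int := twist (fun w => s ^+ deg w).

Lemma deg_cat u v : deg (u ++ v) = (deg u + deg v)%N.
Proof. exact: count_cat. Qed.

Lemma specM s f g : spec s (f * g) = spec s f * spec s g.
Proof. by apply: twistM => u v; rewrite deg_cat exprD. Qed.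

Lemma isrun_deg b d w : isrun b d w -> deg w = if b then size w else 0%N.
Proof.
by elim: w => [|[x y] w IH] /=; [by case: b | case/and3P=> /eqP-> _ /IH->; case: (b)].
Qed.

Lemma spec_run_zeros s d : spec s (run false d) = run false d.
Proof.
apply: funext => w; rewrite /spec /twist /run.
by case: (boolP (isrun _ _ _)) => [/isrun_deg->|]; rewrite ?mul1r ?mulr0.
Qed.

Lemma specN1_run_ones d : spec (-1) (run true d) = size_twist (run true d).
Proof.
apply: funext => w; rewrite /spec /size_twist /twist /run /sgns.
by case: (boolP (isrun _ _ _)) => [/isrun_deg->|]; rewrite ?mulr0.
Qed.

(** As [0 ^+ 0 = 1], multiplying a variable by 0 changes nothing on words of zeros and keeps only
    the empty word of ones. *)
Lemma spec0_run_ones d : spec 0 (run true d) = 1.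
Proof.
apply: funext => w; rewrite /spec /twist /run wfun1.
case: w => [|x w]; first by rewrite mulr1.
case: (boolP (isrun _ _ _)) => [/isrun_deg->|_]; last by rewrite mulr0.
by rewrite exprS !mul0r.
Qed.

Lemma spec_zeros_fun s : spec s zeros_fun = zeros_fun.
Proof. by rewrite specM !spec_run_zeros. Qed.

Lemma spec0_chain_fun : spec 0 chain_fun = zeros_fun.
Proof. by rewrite 2!specM spec_zeros_fun !spec0_run_ones mul1r mulr1. Qed.

Lemma spec1_chain_fun : spec 1 chain_fun = chain_fun.
Proof. by apply: funext => w; rewrite /spec /twist expr1n mul1r. Qed.

Lemma specN1_chain_fun :
  spec (-1) chain_fun = size_twist (run true true) * zeros_fun * size_twist (run true false).
Proof. by rewrite 2!specM spec_zeros_fun !specN1_run_ones. Qed.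

Lemma runVr b d : size_twist (run b d) * run b (~~ d) = 1.
Proof. by rewrite -[run b (~~ d)]size_twistK -size_twistM runV size_twist1. Qed.

(** The inner runs cancel by [runV], then the outer ones. The signs in the values of [rho] come from
    this inverse. *)
Lemma zeros_funV : zeros_fun * size_twist zeros_fun = 1.
Proof.
rewrite size_twistM /zeros_fun mulrA -(mulrA _ (run _ _)) (runV false false) mulr1.
exact: (runV false true).
Qed.

Lemma zeros_funVl : size_twist zeros_fun * zeros_fun = 1.
Proof. by rewrite -{2}[zeros_fun]size_twistK -size_twistM zeros_funV size_twist1. Qed.

Definition signs (M : nat) : seq int :=
  0 :: 1 :: flatten (nseq M [:: -1; 1]) ++ nseq M.*2 0.

Lemma size_signs M : size (signs M) = (M.*2 + M.*2).+2.
Proof.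
rewrite /= size_cat size_flatten /shape map_nseq sumn_nseq size_nseq /=.
by rewrite mul2n.
Qed.

Definition block_fun (M : nat) : wfun int := \prod_(s <- signs M) spec s chain_fun.

(** At each junction of x and -x the facing runs of ones are inverse to each other, while
    [zeros_fun] does not see the sign, so that its powers accumulate. *)
Lemma alternating_block M :
  \prod_(s <- 1 :: flatten (nseq M [:: -1; 1])) spec s chain_fun
    = run true true * zeros_fun ^+ M.*2.+1 * run true false.
Proof.
rewrite big_cons spec1_chain_fun; elim: M => [|M IH]; first by rewrite big_nil mulr1.
rewrite [flatten _]/= !big_cons spec1_chain_fun.
have comm : spec (-1) chain_fun *
    (chain_fun * \prod_(s <- flatten (nseq M [:: -1; 1])) spec s chain_fun)
  = size_twist (run true true) * zeros_fun * zeros_fun ^+ M.*2.+1 * run true false.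
  rewrite IH specN1_chain_fun; move: zeros_fun => c.
  rewrite !mulrA -(mulrA _ (size_twist (run true false)) (run true true)).
  by rewrite (runVr true false) mulr1.
rewrite comm /chain_fun doubleS 2!(exprS _ _.+1); move: zeros_fun => c {IH comm}.
rewrite !mulrA -(mulrA _ (run true false) (size_twist _)) (runV true false) mulr1 //.
Qed.

Lemma block_funE M :
  block_fun M =
    zeros_fun * (run true true * zeros_fun ^+ M.*2.+1 * run true false) * zeros_fun ^+ M.*2.
Proof.
rewrite /block_fun /signs -cat_cons -cat1s !big_cat /= big_seq1 spec0_chain_fun alternating_block.
rewrite mulrA; congr (_ * _).
by elim: (M.*2) => [|k IH]; rewrite ?big_nil // big_cons spec0_chain_fun IH exprS.
Qed.

Definition limit_fun : wfun int :=
  zeros_fun * (run true true * run true false) * size_twist zeros_fun.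

Fixpoint steady (d : bool) (w : word) : bool :=
  if w is x :: w' then ((w' == [::]) || (x.2 == d)) && steady d w' else true.

(* Zeros have smaller labels than ones. *)
Definition valid : pred word := sorted (fun x y : letter => (x.1 == y.1) || (x.2 == x.1)).

(** By validity, a letter of kind [~~ d] followed by one of the other kind has the flag [~~ d]; as
    long as the flags are [d], the kind [~~ d] thus persists. *)
Lemma isrun_steady d x w : valid (x :: w) -> x.1 = ~~ d ->
  isrun (~~ d) d (x :: w) = steady d (x :: w).
Proof.
elim: w x => [|y w IH] x; first by move=> _ /= ->; rewrite eqxx.
case/andP=> xy vw xd.
rewrite -[RHS]/((x.2 == d) && steady d (y :: w)).
rewrite -[LHS]/[&& x.1 == ~~ d, x.2 == d & isrun (~~ d) d (y :: w)] xd eqxx /=.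
case: eqP => //= x2; apply: IH => //.
by move: xy; rewrite xd x2; case: (d); case: y.1.
Qed.

(** The only cut that can contribute is where the letters change from kind [d] to kind [~~ d],
    possibly at an end. [run] ignores the flag there, but validity forces it to be [d]. *)
Lemma run_steady d w : valid w -> (run d d * run (~~ d) d) w = (steady d w)%:R.
Proof.
elim: w => [|x w IH] // vw; rewrite wfunM_cons wder_run !(wscaleAl, mulrDl).
rewrite !(wscaleE, wfunD) (mul1r (run _ _)) IH; last exact: path_sorted vw.
rewrite -[run d d [::]]/(1 : int) mul1r.
case: (x.1 =P d) => xd; last first.
  by rewrite mul0r addr0 /run isrun_steady //; move: xd; case: x.1; case: (d).
rewrite mul1r {1}/run -[isrun _ _ (_ :: _)]/[&& _, _ & _].
have -> : (x.1 == ~~ d) = false by rewrite xd; case: (d).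
rewrite add0r /=; case: w vw {IH} => [|y w] vw /=; first by case: eqP.
case: (x.2 =P d) => x2 /=; first by rewrite mul1r mul0r addr0.
rewrite mul0r mul1r add0r /run /=.
case/andP: vw => /orP[/eqP<-|/eqP x2x _]; last by case: x2; rewrite x2x.
by rewrite xd; case: (d).
Qed.

(** * Series attached to words *)

Definition lift (R : comNzRingType) (f : wfun int) : wfun R := fun w => (f w)%:~R.

(** The empty word gets 1 and not [v 0]: a variable used by no element is absent, whereas one used
    by zeros only leaves x ^ 0, which differs from 1. *)
Definition mark (R : comNzRingType) (v : nat -> R) (w : word) : R :=
  if w is [::] then 1 else v (deg w).

Definition marked (R : comNzRingType) (v : nat -> R) (f : wfun int) : wfun R :=
  twist (mark v) (lift R f).

Section Mark.
Variable R : comNzRingType.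

Lemma lift1 : lift R 1 = 1.
Proof. by apply: funext => w; rewrite /lift !wfun1; case: (w == _). Qed.

Lemma liftM f g : lift R (f * g) = lift R f * lift R g.
Proof.
apply: funext => w; rewrite /lift !wfunM rmorph_sum.
by apply: eq_bigr => k _; rewrite rmorphM.
Qed.

Lemma marked_nil (v : nat -> R) f : f [::] = 1 -> marked v f [::] = 1.
Proof. by rewrite /marked /twist /lift /= => ->; rewrite mul1r. Qed.

Lemma marked_ne (v : nat -> R) f w : w != [::] -> marked v f w = v (deg w) *~ f w.
Proof. by case: w => // x w _; rewrite /marked /twist /lift mulrzr. Qed.

Variables (v : nat -> R) (vM : forall a b, v (a + b)%N = v a * v b).

Lemma markM u w : mark v (u ++ w) = mark v u * mark v w.
Proof.
case: u w => [|x u] [|y w]; rewrite ?cats0 ?mul1r ?mulr1 //.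
by rewrite -[LHS]/(v (deg ((x :: u) ++ y :: w))) deg_cat vM.
Qed.

Lemma marked1 : marked v 1 = 1.
Proof. by rewrite /marked lift1 twist1. Qed.

Lemma markedM f g : marked v (f * g) = marked v f * marked v g.
Proof. by rewrite /marked liftM (twistM markM). Qed.

Lemma marked_prod (I : Type) (r : seq I) (F : I -> wfun int) :
  marked v (\prod_(i <- r) F i) = \prod_(i <- r) marked v (F i).
Proof. exact: (big_morph _ markedM marked1). Qed.

End Mark.

Definition part (a : nat) (f : wfun int) : wfun int :=
  fun w => if (w != [::]) && (deg w == a) then f w else 0.

Definition parts (f : wfun int) (e : seq nat) : wfun int := \prod_(a <- e) part a f.

(* The coefficient of x_1 ^ e_1 ... x_r ^ e_r sums over the factorizations of w into
   nonempty factors with e_1, ..., e_r ones. *)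
Definition word_series (f : wfun int) (w : word) : pseries := fun m => parts f (expts m) w.

Definition mons (q : mono) : pseries := fun m => (m == q)%:R.

Definition xvar (i a : nat) : pseries := mons (mvar i a).

Lemma pmul_mons f q m : (f * mons q) m = \sum_(p <- facs m | mmul p q == m) f p.
Proof.
rewrite -[LHS]pmul_def big_mkcond; apply: eq_bigr => p _; rewrite /mons.
rewrite big_mkcond; case: eqP => [E|nE].
  have qm : q \in facs m by apply: (@facs_factor _ _ p); rewrite mmulC.
  rewrite (bigD1_seq q) ?uniq_facs //= E !eqxx mulr1 big1 ?addr0 // => r /negbTE->.
  by rewrite mulr0 if_same.
rewrite big1 // => r _; case: eqP => // E; case: eqP => [rq|]; rewrite ?mulr0 //.
by case: nE; rewrite -rq.
Qed.

Lemma monsM p q : mons p * mons q = mons (mmul p q).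
Proof.
apply: funext => m; rewrite pmul_mons /mons big_mkcond.
case: (eqVneq m (mmul p q)) => [E|nE].
  have pm : p \in facs m by apply: (@facs_factor _ _ q).
  rewrite (bigD1_seq p) ?uniq_facs //= E !eqxx big1 ?addr0 // => r /negbTE->.
  by case: ifP.
rewrite big1 // => r _; case: eqP => // E; case: eqP => // rp.
by rewrite -E rp eqxx in nE.
Qed.

Lemma mons1 : mons mone = 1.
Proof. by []. Qed.

Lemma mvarE i a k : mvar i a k = if k == i then Some a else None.
Proof. by rewrite fsfunE inE. Qed.

Lemma mvarM i a b : mmul (mvar i a) (mvar i b) = mvar i (a + b).
Proof. by apply/fsfunP => k; rewrite mmulE !mvarE; case: eqP. Qed.

Lemma xvarM i a b : xvar i (a + b)%N = xvar i a * xvar i b.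
Proof. by rewrite monsM mvarM. Qed.

Definition below (A : nat) (m : mono) : Prop := forall k, (A <= k)%N -> m k = None.

Definition mtrunc (A : nat) (m : mono) : mono :=
  [fsfun k in finsupp m => if (k < A)%N then m k else None | None].

Lemma mtruncE A m k : mtrunc A m k = if (k < A)%N then m k else None.
Proof.
rewrite fsfunE; case: ifP => // /negbT; rewrite mem_finsupp negbK => /eqP->.
by case: ifP.
Qed.

Definition exps (A : nat) (m : mono) : seq nat := pmap m (iota 0 A).

Lemma expts_below A m : below A m -> expts m = exps A m.
Proof.
move=> mA; rewrite /expts /exps.
have -> : sort leq (finsupp m) = [seq k <- iota 0 A | m k != None].
  apply: (sorted_eq leq_trans anti_leq).
  - exact: (sort_sorted leq_total).
  - by apply: sorted_filter; [exact: leq_trans | exact: iota_sorted].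
  apply: uniq_perm; rewrite ?sort_uniq ?fset_uniq ?filter_uniq ?iota_uniq // => k.
  rewrite mem_sort mem_finsupp mem_filter mem_iota add0n /=.
  by case: ltnP; rewrite ?andbT // => /mA ->; rewrite eqxx.
by elim: (iota 0 A) => //= k r; case E: (m k) => [a|] /= IH; rewrite ?E /= IH.
Qed.

(** The monomials of [f] avoid variable [A] and all later ones, so [m] factors in at most one way,
    as its truncation times its power of that variable. *)
Lemma pmul_xvar A a (f : pseries) m :
  (forall p, f p != 0 -> below A p) -> below A.+1 m ->
  (f * xvar A a) m = if m A == Some a then f (mtrunc A m) else 0.
Proof.
move=> fA mA; rewrite pmul_mons.
have key p : below A p -> mmul p (mvar A a) = m -> m A = Some a /\ p = mtrunc A m.
  move=> pA <-; rewrite mmulE mvarE eqxx pA //; split=> //.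
  apply/fsfunP => k; rewrite mtruncE mmulE mvarE; case: ltnP => [kA|/pA->//].
  by rewrite (ltn_eqF kA); case: (p k).
case: eqP => [Ea|nE]; last first.
  rewrite big1_seq // => p /andP[/eqP E _]; apply/eqP/negPn/negP => /fA /key /(_ E)[].
  by move/nE.
have E : mmul (mtrunc A m) (mvar A a) = m.
  apply/fsfunP => k; rewrite mmulE mtruncE mvarE.
  by case: (ltngtP k A) => [kA|kA|->]; [case: (m k) | rewrite (mA _ kA) | rewrite Ea].
rewrite big_mkcond (bigD1_seq (mtrunc A m)) ?uniq_facs //=; last exact: facs_factor E.
rewrite E eqxx big1 ?addr0 // => p /eqP np; case: eqP => // Ep.
by apply/eqP/negPn/negP => /fA /key /(_ Ep)[_ /np].
Qed.

Lemma psMz (f : pseries) c m : (f *~ c) m = f m *~ c.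
Proof.
have H n : (f *+ n) m = f m *+ n by elim: n => // n IH; rewrite !mulrS psDE IH.
by case: c => n; rewrite ?pmulrn ?NegzE ?mulrNz ?psNE -?pmulrn H.
Qed.

Lemma ps_sum I (r : seq I) (P : pred I) (F : I -> pseries) m :
  (\sum_(i <- r | P i) F i) m = \sum_(i <- r | P i) F i m.
Proof. exact: (big_morph (fun f : pseries => f m)). Qed.

Lemma below_ex m : exists A, below A m.
Proof.
exists (\max_(k : finsupp m) val k).+1 => k; apply: contraTeq; rewrite -mem_finsupp.
by move=> km; rewrite -ltnNge ltnS (leq_bigmax [` km]%fset).
Qed.

Lemma exps_cat A m : exps A.+1 m = exps A m ++ (if m A is Some a then [:: a] else [::]).
Proof. by rewrite /exps -addn1 iotaD pmap_cat /= add0n; case: (m A). Qed.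

Lemma exps_trunc A m : exps A (mtrunc A m) = exps A m.
Proof.
rewrite /exps; suff : {in iota 0 A, mtrunc A m =1 m}.
  by elim: (iota 0 A) => //= k r IH h; rewrite h ?mem_head // IH // => x xr;
     rewrite h // in_cons xr orbT.
by move=> k; rewrite mem_iota mtruncE add0n => /andP[_ ->].
Qed.

Lemma parts_cat f e1 e2 : parts f (e1 ++ e2) = parts f e1 * parts f e2.
Proof. exact: big_cat. Qed.

Lemma below_trunc A m : below A (mtrunc A m).
Proof. by move=> k kA; rewrite mtruncE ltnNge kA. Qed.

Lemma below_S A m : below A.+1 m -> m A = None -> below A m.
Proof. by move=> mA Ea k; rewrite leq_eqVlt => /orP[/eqP<-|/mA]. Qed.

(** The two claims need a joint induction: adding a variable uses [pmul_xvar], which asks for the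
    bound on the previous product. *)
Lemma prod_marked (f : wfun int) (f0 : f [::] = 1) A w m :
  (below A m -> (\prod_(i < A) marked (xvar i) f) w m = parts f (exps A m) w) /\
  ((\prod_(i < A) marked (xvar i) f) w m != 0 -> below A m).
Proof.
elim: A w m => [|A IH] w m.
  rewrite big_ord0 wfun1 /exps /parts big_nil wfun1; split=> [m0|].
    have -> : m = mone by apply/fsfunP => k; rewrite m0 // moneE.
    by case: (w == _); rewrite // -[LHS]/((mons mone) mone) /mons eqxx.
  case: (w == _); last by move/eqP.
  rewrite -[X in X != 0 -> _]/((mons mone) m) /mons.
  by case: (m =P mone) => [-> _ k _|_ /eqP//]; rewrite moneE.
set P := fun w => (\prod_(i < A) marked (xvar i) f) w.
have PA u p : P u p != 0 -> below A p by case: (IH u p).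
have PE u p : below A p -> P u p = parts f (exps A p) u by case: (IH u p).
have E : (\prod_(i < A.+1) marked (xvar i) f) w m =
    \sum_(k < (size w).+1) (if drop k w == [::] then P (take k w) m else
       (P (take k w) * xvar A (deg (drop k w))) m * f (drop k w)).
  have -> : \prod_(i < A.+1) marked (xvar i) f
      = (\prod_(i < A) marked (xvar i) f) * marked (xvar A) f by rewrite big_ord_recr.
  rewrite wfunM ps_sum; apply: eq_bigr => k _.
  rewrite -/(P _); case: eqP => [->|/eqP ne]; first by rewrite marked_nil // (mulr1 (P _)).
  by rewrite marked_ne // mulrzAr psMz -mulrzr intz.
split=> [mA|].
  rewrite {}E exps_cat parts_cat wfunM; case Ea: (m A) => [a|].
    apply: eq_bigr => k _; rewrite /parts big_seq1 -/(parts f _) /part.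
    case: eqP => [->|_] /=.
      rewrite mulr0; apply/eqP/negPn/negP => /PA /(_ A (leqnn _)).
      by rewrite Ea.
    rewrite pmul_xvar //; last by move=> p; apply: PA.
    rewrite Ea PE; last exact: below_trunc.
    rewrite exps_trunc -[Some a == Some _]/(a == _) [a == _]eq_sym.
    by case: eqP => _; rewrite ?mul0r ?mulr0.
  (* Variable [A] is absent from [m], so only the last cut, which gives it the empty factor,
     survives. *)
  rewrite [RHS]big_ord_recr [LHS]big_ord_recr /= drop_size take_size eqxx.
  rewrite /parts big_nil wfun1 eqxx mulr1 -/(parts f _) PE; last exact: below_S.
  congr (_ + _); apply: eq_bigr => k _.
  have -> : drop k w == [::] = false.
    by rewrite -size_eq0 size_drop subn_eq0 leqNgt ltn_ord.
  rewrite wfun1; have -> : drop k w == [::] = false.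
    by rewrite -size_eq0 size_drop subn_eq0 leqNgt ltn_ord.
  rewrite pmul_xvar //; last by move=> p; apply: PA.
  by rewrite Ea mul0r mulr0.
rewrite {}E => nz; suff /existsP[k] : [exists k : 'I_(size w).+1,
    (if drop k w == [::] then P (take k w) m else
       (P (take k w) * xvar A (deg (drop k w))) m * f (drop k w)) != 0].
  case: ifP => _; first by move/PA => mA j /ltnW /mA.
  rewrite mulf_eq0 negb_or => /andP[+ _]; rewrite pmul_mons => /eqP nz'.
  have /hasP[p _ /andP[/eqP <- /PA pA]] :
      has (fun p => (mmul p (mvar A (deg (drop k w))) == m) && (P (take k w) p != 0))
          (facs m).
    apply/hasPn => h; apply: nz'; rewrite big1_seq // => p /andP[pm pf].
    by have := h p pf; rewrite pm /= negbK => /eqP.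
  by move=> j Aj; rewrite mmulE mvarE (pA j (ltnW Aj)) (gtn_eqF Aj).
apply/existsP; apply: contra_notP (elimN eqP nz) => h.
by rewrite big1 // => k _; apply/eqP/negPn/negP => hk; apply: h; exists k.
Qed.

(** This avoids infinite products: each coefficient of a word series is one of a finite product, for
    every [A] beyond the variables of [m]. *)
Lemma word_series_prod (f : wfun int) A w m : f [::] = 1 -> below A m ->
  (\prod_(i < A) marked (xvar i) f) w m = word_series f w m.
Proof.
by move=> f0 mA; rewrite (proj1 (prod_marked f0 A w m)) // /word_series (expts_below mA).
Qed.

(** * Substituting blocks of variables *)

(** Replaces the support of a monomial by a range that two monomials and their product can share, as
    the multiplicativity proofs need. *)
Lemma big_finsupp (T : Type) (idx : T) (op : Monoid.com_law idx)
    (F : nat -> option nat -> T) A (p : mono) :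
  (forall k, F k None = idx) -> below A p ->
  \big[op/idx]_(k <- finsupp p) F k (p k) = \big[op/idx]_(i < A) F i (p i).
Proof.
move=> FN pA; rewrite -(big_mkord xpredT (fun i => F i (p i))) /index_iota subn0.
rewrite [RHS](bigID (fun i => i \in finsupp p)) /= [X in op _ X]big1; last first.
  by move=> k; rewrite mem_finsupp negbK => /eqP->.
rewrite Monoid.mulm1 -[RHS]big_filter; apply: perm_big.
apply: uniq_perm; rewrite ?fset_uniq ?filter_uniq ?iota_uniq // => k.
rewrite mem_filter mem_iota add0n /= mem_finsupp.
by case: ltnP; rewrite ?andbT // => /pA ->; rewrite eqxx.
Qed.

Section Transfer.
Variables (n : nat) (sg : nat -> int).

Definition omvar (j : nat) (o : option nat) : mono :=
  if o is Some a then mvar j a else mone.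

Definition blockmono (p : mono) : mono :=
  \big[mmul/mone]_(k <- finsupp p) omvar (k %/ n)%N (p k).

(** For [sg k = 0] the factor is still 1 when variable [k] is absent or has exponent 0. *)
Definition weight_sign (p : mono) : int := \prod_(k <- finsupp p) sg k ^+ odflt 0%N (p k).

Lemma below_mmul A p q : below A p -> below A q -> below A (mmul p q).
Proof. by move=> pA qA k kA; rewrite mmulE pA ?qA. Qed.

Lemma below_leq A B p : (A <= B)%N -> below A p -> below B p.
Proof. by move=> AB pA k Bk; apply: pA; apply: leq_trans AB Bk. Qed.

Lemma below_ex2 p q : exists2 A, below A p & below A q.
Proof.
have [A pA] := below_ex p; have [B qB] := below_ex q.
by exists (maxn A B); [apply: below_leq pA | apply: below_leq qB];
  rewrite ?leq_maxl ?leq_maxr.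
Qed.

Lemma blockmonoM p q : blockmono (mmul p q) = mmul (blockmono p) (blockmono q).
Proof.
have [A pA qA] := below_ex2 p q.
have FN k : omvar (k %/ n)%N None = mone by [].
have H p' := @big_finsupp _ mone mmul (fun k => omvar (k %/ n)%N) A p' FN.
rewrite /blockmono !H //; last exact: below_mmul.
rewrite -big_split; apply: eq_bigr => i _ /=; rewrite mmulE.
by case: (p i) (q i) => [a|] [b|] /=; rewrite -?mvarM ?mmul1 // mmulC mmul1.
Qed.

Lemma weight_signM p q : weight_sign (mmul p q) = weight_sign p * weight_sign q.
Proof.
have [A pA qA] := below_ex2 p q.
have FN k : sg k ^+ odflt 0%N None = 1 by [].
have H p' := @big_finsupp _ 1 *%R (fun k o => sg k ^+ odflt 0%N o) A p' FN.
rewrite /weight_sign !H //; last exact: below_mmul.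
rewrite -big_split; apply: eq_bigr => i _ /=; rewrite mmulE.
by case: (p i) (q i) => [a|] [b|] /=; rewrite ?exprD ?mul1r ?mulr1.
Qed.

Lemma finsupp_mvar i a : finsupp (mvar i a) = [fset i]%fset.
Proof. by apply/fsetP => k; rewrite mem_finsupp mvarE in_fset1; case: (k == i). Qed.

Lemma blockmono_mvar i a : blockmono (mvar i a) = mvar (i %/ n)%N a.
Proof. by rewrite /blockmono finsupp_mvar big_seq_fset1 mvarE eqxx. Qed.

Lemma weight_sign_mvar i a : weight_sign (mvar i a) = sg i ^+ a.
Proof. by rewrite /weight_sign finsupp_mvar big_seq_fset1 mvarE eqxx. Qed.

Lemma blockmono1 : blockmono mone = mone.
Proof. by rewrite /blockmono /mone finsupp0 big_seq_fset0. Qed.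

Lemma weight_sign1 : weight_sign mone = 1.
Proof. by rewrite /weight_sign /mone finsupp0 big_seq_fset0. Qed.

Lemma blockmono_le (p : mono) k a : p k = Some a ->
  exists2 b, blockmono p (k %/ n)%N = Some b & (a <= b)%N.
Proof.
move=> pk; have kp : k \in finsupp p by rewrite mem_finsupp pk.
rewrite /blockmono (bigD1_seq k) ?fset_uniq //= mmulE pk mvarE eqxx.
case: (X in oadd _ X) => [b|] /=; last by exists a.
by exists (a + b)%N; rewrite ?leq_addr.
Qed.

Hypothesis n_gt0 : (0 < n)%N.

Definition bound (m : mono) : nat := (\max_(k : finsupp m) val k).+1.

Lemma below_bound m : below (bound m) m.
Proof.
move=> k; apply: contraTeq; rewrite -mem_finsupp.
by move=> km; rewrite -ltnNge ltnS (leq_bigmax [` km]%fset).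
Qed.

(* The preimages of m under blockmono are factors of pull m. *)
Definition pull (m : mono) : mono :=
  [fsfun k in [fset k in iota 0 (bound m * n)]%fset => m (k %/ n)%N | None].

Lemma pullE m k : pull m k = m (k %/ n)%N.
Proof.
rewrite fsfunE inE /= mem_iota add0n /=; case: ltnP => // h.
by rewrite below_bound // leq_divRL.
Qed.

Definition fiber (m : mono) : seq mono := [seq p <- facs (pull m) | blockmono p == m].

Lemma mem_fiber p m : (p \in fiber m) = (blockmono p == m).
Proof.
rewrite mem_filter; case: eqP => //= E.
(* The complementary factor of [p]; the truncated subtraction is exact by [blockmono_le]. *)
pose q : mono := [fsfun k in finsupp (pull m) =>
  omap (fun b => b - odflt 0%N (p k))%N (pull m k) | None].
have qE k : q k = omap (fun b => b - odflt 0%N (p k))%N (m (k %/ n)%N).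
  by rewrite fsfunE mem_finsupp pullE; case: (m _).
apply: (@facs_factor _ _ q); apply/fsfunP => k; rewrite mmulE qE pullE.
case Ek: (p k) => [a|] /=; last by case: (m _) => //= b; rewrite subn0.
have [b Eb ab] := blockmono_le Ek; rewrite -E Eb /=.
by rewrite subnKC.
Qed.

Lemma uniq_fiber m : uniq (fiber m).
Proof. by rewrite filter_uniq ?uniq_facs. Qed.

(** Substitutes [sg k] times variable [k %/ n] for variable [k]. Blocks are finite, hence so are the
    fibers, and all series are allowed. *)
Definition transfer (f : pseries) : pseries := fun m => \sum_(p <- fiber m) weight_sign p * f p.

Lemma transferE (X : seq mono) f m : uniq X -> {subset fiber m <= X} ->
  transfer f m = \sum_(p <- X | blockmono p == m) weight_sign p * f p.
Proof.
move=> uX sX; rewrite -[RHS]big_filter; apply: perm_big.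
apply: uniq_perm; rewrite ?uniq_fiber ?filter_uniq // => p.
rewrite [RHS]mem_filter mem_fiber; case: eqP => //= E.
by apply/esym/sX; rewrite mem_fiber E.
Qed.

Lemma transferD f g : transfer (f + g) = transfer f + transfer g.
Proof.
apply: funext => m; rewrite psDE -big_split; apply: eq_bigr => p _.
by rewrite psDE mulrDr.
Qed.

Lemma transfer_mons q : transfer (mons q) = mons (blockmono q) *~ weight_sign q.
Proof.
apply: funext => m; rewrite psMz /mons /transfer; case: eqP => [E|nE].
  rewrite (bigD1_seq q) ?uniq_fiber ?mem_fiber ?E //= eqxx big1 ?addr0 => [|p /negbTE->].
    by rewrite mulr1 intz.
  by rewrite mulr0.
rewrite mul0rz big1_seq // => p; rewrite mem_fiber /= => /eqP E.
by case: eqP => [Ep|]; rewrite ?mulr0 //; case: nE; rewrite -E Ep.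
Qed.

Lemma transferM f g : transfer (f * g) = transfer f * transfer g.
Proof.
apply: funext => m.
(* All monomials whose image divides [m]; both factors of any product in the fiber of [m] lie
   here. *)
pose X := undup (flatten [seq fiber a | a <- facs m]).
have uX : uniq X by exact: undup_uniq.
have memX q : (q \in X) = (blockmono q \in facs m).
  rewrite mem_undup; apply/flatten_mapP/idP => [[a am]|qm].
    by rewrite mem_fiber => /eqP->.
  by exists (blockmono q); rewrite ?mem_fiber.
have sX a : a \in facs m -> {subset fiber a <= X}.
  by move=> am q; rewrite mem_fiber memX => /eqP->.
have facX q r : blockmono (mmul q r) = m -> q \in X.
  by rewrite blockmonoM memX; apply: facs_factor.
(* Common form of both sides: pairs of monomials whose product maps to [m]. *)
transitivity (\sum_(q <- X) \sum_(r <- X | blockmono (mmul q r) == m)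
    (weight_sign q * f q) * (weight_sign r * g r)).
  transitivity (\sum_(p <- fiber m) \sum_(q <- X) \sum_(r <- X)
      if mmul q r == p then (weight_sign q * f q) * (weight_sign r * g r) else 0).
    rewrite /transfer [LHS]big_seq [RHS]big_seq; apply: eq_bigr => p.
    rewrite mem_fiber => /eqP pm.
    have -> : (f * g) p = \sum_(q <- X) \sum_(r <- X | mmul q r == p) f q * g r.
      by apply: pmulE => // q r E; apply: (facX _ r); rewrite E.
    rewrite mulr_sumr; apply: eq_bigr => q _; rewrite mulr_sumr -big_mkcond.
    by apply: eq_bigr => r /eqP <-; rewrite weight_signM mulrACA.
  rewrite exchange_big; apply: eq_bigr => q _; rewrite exchange_big.
  rewrite [RHS]big_mkcond; apply: eq_bigr => r _ /=; case: eqP => E.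
    rewrite (bigD1_seq (mmul q r)) ?uniq_fiber ?mem_fiber ?E //= eqxx big1 ?addr0 //.
    by move=> p; rewrite eq_sym => /negbTE->.
  rewrite big1_seq // => p; rewrite mem_fiber /= => /eqP pm.
  by case: eqP => // Ep; case: E; rewrite Ep.
rewrite -[RHS]pmul_def [RHS]pmul_def.
transitivity (\sum_(a <- facs m) \sum_(q <- X) \sum_(b <- facs m) \sum_(r <- X)
   if [&& mmul a b == m, blockmono q == a & blockmono r == b]
   then (weight_sign q * f q) * (weight_sign r * g r) else 0).
  rewrite [RHS]exchange_big [LHS]big_seq [RHS]big_seq; apply: eq_bigr => q; rewrite memX => qm.
  rewrite (bigD1_seq (blockmono q)) ?uniq_facs //= [X in _ + X]big1 ?addr0; last first.
    move=> a; rewrite eq_sym => /negbTE na; rewrite big1 // => b _.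
    by rewrite big1 // => r _; rewrite na andbF.
  rewrite [RHS]exchange_big [LHS]big_mkcond [LHS]big_seq [RHS]big_seq.
  apply: eq_bigr => r; rewrite memX => rm.
  rewrite (bigD1_seq (blockmono r)) ?uniq_facs //= !eqxx andbT big1 ?addr0.
    by rewrite blockmonoM andbT.
  by move=> b; rewrite eq_sym => /negbTE nb; rewrite nb !andbF.
rewrite [LHS]big_seq [RHS]big_seq; apply: eq_bigr => a am.
rewrite [LHS]exchange_big [LHS]big_seq [RHS]big_seq_cond /= [RHS]big_mkcondr.
apply: eq_bigr => b bm; case: eqP => abm; last first.
  by rewrite big1 // => q _; rewrite big1.
rewrite (transferE f uX (sX a am)) (transferE g uX (sX b bm)).
rewrite mulr_suml [RHS]big_mkcond; apply: eq_bigr => q _.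
case: eqP => _; last by rewrite big1.
by rewrite mulr_sumr [RHS]big_mkcond; apply: eq_bigr => r _.
Qed.

Lemma transfer1 : transfer 1 = 1.
Proof. by rewrite -mons1 transfer_mons blockmono1 weight_sign1. Qed.

End Transfer.

Lemma prod_block (R : nzRingType) (F : nat -> R) (G : int -> R) (j : nat) (ss : seq int) :
  (forall t, (t < size ss)%N -> F (t + j * size ss)%N = G (nth 0 ss t)) ->
  \prod_(j * size ss <= i < j.+1 * size ss) F i = \prod_(s <- ss) G s.
Proof.
move=> FG; rewrite [RHS](big_nth 0) -{1}[(j * _)%N]add0n big_addn mulSn addnK.
by rewrite big_nat [RHS]big_nat; apply: eq_bigr => t /andP[_ /FG].
Qed.

Section TransferSer.
Variables (ss : seq int) (ss_gt0 : (0 < size ss)%N).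

Definition letter_sign (i : nat) : int := nth 0 ss (i %% size ss)%N.

Definition subst_letters : pseries -> pseries := transfer (size ss) letter_sign.

Lemma subst_sum (I : Type) (r : seq I) (F : I -> pseries) :
  subst_letters (\sum_(i <- r) F i) = \sum_(i <- r) subst_letters (F i).
Proof.
apply: big_morph; first exact: transferD.
by apply: funext => m; rewrite /subst_letters /transfer big1 // => p _; rewrite mulr0.
Qed.

Lemma substMz f c : subst_letters (f *~ c) = subst_letters f *~ c.
Proof.
apply: funext => m; rewrite psMz /subst_letters /transfer mulrz_suml.
by apply: eq_bigr => p _; rewrite psMz mulrzAr.
Qed.

Definition wmap (T : pseries -> pseries) (f : wfun pseries) : wfun pseries :=
  fun w => T (f w).

Lemma wmapM f g : wmap subst_letters (f * g) = wmap subst_letters f * wmap subst_letters g.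
Proof.
apply: funext => w; rewrite /wmap !wfunM subst_sum.
by apply: eq_bigr => k _; rewrite -transferM.
Qed.

Lemma wmap1 : wmap subst_letters 1 = 1.
Proof.
apply: funext => w; rewrite /wmap !wfun1; case: (w == _); first exact: transfer1.
by have := @subst_sum nat [::] (fun=> 0); rewrite !big_nil.
Qed.

Lemma subst_xvar i a : subst_letters (xvar i a) =
  xvar (i %/ size ss)%N a *~ (letter_sign i ^+ a).
Proof. by rewrite /subst_letters transfer_mons // blockmono_mvar weight_sign_mvar. Qed.

Lemma wmap_marked (f : wfun int) i : f [::] = 1 ->
  wmap subst_letters (marked (xvar i) f) = marked (xvar (i %/ size ss)%N) (spec (letter_sign i) f).
Proof.
move=> f0; have s0 : spec (letter_sign i) f [::] = 1 by rewrite /spec /twist f0.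
apply: funext => w; rewrite /wmap; case: (eqVneq w [::]) => [->|ne].
  apply: etrans (esym (marked_nil _ s0)); transitivity (subst_letters 1); last exact: transfer1.
  by congr subst_letters; exact: marked_nil.
apply: etrans (esym (marked_ne _ _ ne)).
transitivity (subst_letters (xvar i (deg w) *~ f w)).
  by congr subst_letters; exact: marked_ne.
by rewrite substMz subst_xvar -mulrzA.
Qed.

(** If [m] involves only the first [A] variables, its fiber involves only the first [A * size ss].
    On the product over these the substitution acts factor by factor, and the factors group into [A]
    blocks. *)
Lemma subst_word_series (f : wfun int) w : f [::] = 1 ->
  subst_letters (word_series f w) = word_series (\prod_(s <- ss) spec s f) w.
Proof.
move=> f0; apply: funext => m; have [A mA] := below_ex m.
have -> : subst_letters (word_series f w) m =
    wmap subst_letters (\prod_(i < A * size ss) marked (xvar i) f) w m.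
  rewrite /wmap /subst_letters /transfer big_seq [RHS]big_seq.
  apply: eq_bigr => p; rewrite mem_fiber // => /eqP pm; rewrite word_series_prod // => k Ak.
  case Ek: (p k) => [a|] //; have [b] := blockmono_le (size ss) Ek.
  by rewrite pm mA // leq_divRL.
rewrite (big_morph _ wmapM wmap1).
have -> : \prod_(i < A * size ss) wmap subst_letters (marked (xvar i) f)
    = \prod_(j < A) marked (xvar j) (\prod_(s <- ss) spec s f).
  rewrite -(big_mkord xpredT (fun i => wmap subst_letters (marked (xvar i) f))).
  rewrite big_nat_mul big_mkord; apply: eq_bigr => j _.
  transitivity (\prod_(s <- ss) marked (xvar j) (spec s f)).
    apply: prod_block => t tn; apply: etrans (wmap_marked _ f0) _.
    have -> : ((t + j * size ss) %/ size ss)%N = j.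
      by rewrite addnC divnMDl // divn_small // addn0.
    have -> : letter_sign (t + j * size ss) = nth 0 ss t; last by [].
    by rewrite /letter_sign addnC modnMDl modn_small.
  exact/esym/marked_prod/xvarM.
apply: word_series_prod => //.
by elim: (ss) => [|s r IH]; rewrite ?big_nil // big_cons wfunM_nil IH /spec /twist f0.
Qed.

End TransferSer.

(** * The limit *)

(* A divisibility substitute for "F M is a rational polynomial in 2M + 1 with constant
   term c", which only involves integers. *)
Definition ilim (F : nat -> int) (c : int) : Prop :=
  exists2 D : nat, (0 < D)%N & forall M, (M.*2.+1 %| D%:Z * (F M - c))%Z.

Lemma ilim_unique F c c' : ilim F c -> ilim F c' -> c = c'.
Proof.
move=> [D D0 hD] [D' D'0 hD']; apply/eqP; rewrite -subr_eq0; apply/negPn/negP => ne.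
pose x := (D * D')%:Z * (c - c').
have hx M : (M.*2.+1 %| x)%Z.
  have -> : x = D%:Z * (D'%:Z * (F M - c')) - D'%:Z * (D%:Z * (F M - c)).
    by rewrite /x PoszM; ring.
  by rewrite rpredB // dvdz_mull.
have : x != 0 by rewrite mulf_neq0 // eqz_nat -lt0n muln_gt0 D0.
(* At M = |x| the modulus 2|x| + 1 exceeds |x|, so it cannot divide a nonzero x. *)
have := hx `|x|%N; rewrite dvdzE /=; move/dvdn_leq => h x0.
have /h : (0 < `|x|)%N by rewrite absz_gt0.
by rewrite leqNgt -addnn ltnS leq_addr.
Qed.

Lemma ilim_cst c : ilim (fun=> c) c.
Proof. by exists 1%N => // M; rewrite subrr mulr0 dvdz0. Qed.

Lemma ilim_ext F G c : F =1 G -> ilim F c -> ilim G c.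
Proof. by move=> FG [D D0 h]; exists D => // M; rewrite -FG. Qed.

Lemma ilimD F G c d : ilim F c -> ilim G d -> ilim (fun M => F M + G M) (c + d).
Proof.
move=> [D D0 hD] [E E0 hE]; exists (D * E)%N => [|M]; first by rewrite muln_gt0 D0.
have -> : (D * E)%:Z * (F M + G M - (c + d))
    = E%:Z * (D%:Z * (F M - c)) + D%:Z * (E%:Z * (G M - d)) by rewrite PoszM; ring.
by rewrite rpredD // dvdz_mull.
Qed.

Lemma ilimM F G c d : ilim F c -> ilim G d -> ilim (fun M => F M * G M) (c * d).
Proof.
move=> [D D0 hD] [E E0 hE]; exists (D * E)%N => [|M]; first by rewrite muln_gt0 D0.
have -> : (D * E)%:Z * (F M * G M - c * d)
    = (E%:Z * G M) * (D%:Z * (F M - c)) + (D%:Z * c) * (E%:Z * (G M - d)).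
  by rewrite PoszM; ring.
by rewrite rpredD // dvdz_mull.
Qed.

Lemma ilim_sum I (r : seq I) (P : pred I) (F : I -> nat -> int) (c : I -> int) :
  (forall i, ilim (F i) (c i)) ->
  ilim (fun M => \sum_(i <- r | P i) F i M) (\sum_(i <- r | P i) c i).
Proof.
move=> h; elim: r => [|i r IH].
  by apply: ilim_ext (ilim_cst _) => M; rewrite !big_nil.
rewrite big_cons; case Pi: (P i).
  by apply: ilim_ext (ilimD (h i) IH) => M; rewrite big_cons Pi.
by apply: ilim_ext IH => M; rewrite big_cons Pi.
Qed.

(** For k > 0, multiplying by k! gives a falling factorial whose first factor is 2M + 1. *)
Lemma ilim_bin k : ilim (fun M => 'C(M.*2.+1, k)%:Z) (k == 0%N)%:Z.
Proof.
case: k => [|k]; first by apply: ilim_ext (ilim_cst _) => M; rewrite bin0.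
exists (k.+1)`!; first exact: fact_gt0.
by move=> M; rewrite subr0 -PoszM mulnC bin_ffact ffactnS dvdzE dvdn_mulr.
Qed.

Definition wlim (F : nat -> wfun int) (f : wfun int) : Prop :=
  forall w, ilim (fun M => F M w) (f w).

Lemma wlim_cst f : wlim (fun=> f) f.
Proof. by move=> w; exact: ilim_cst. Qed.

Lemma wlimM F G f g : wlim F f -> wlim G g -> wlim (fun M => F M * G M) (f * g).
Proof.
move=> Ff Gg w; rewrite wfunM.
have h k : ilim (fun M => F M (take k w) * G M (drop k w)) (f (take k w) * g (drop k w)).
  exact: ilimM.
have := @ilim_sum _ (index_enum 'I_(size w).+1) xpredT _ _ h.
by apply: ilim_ext => M; rewrite wfunM.
Qed.

Lemma wexp_small (f : wfun int) k w : f [::] = 0 -> (size w < k)%N -> (f ^+ k) w = 0.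
Proof.
move=> f0; elim: k w => [|k IH] w //; rewrite ltnS => wk.
rewrite exprS wfunM big1 // => -[[|i] /= _] _; first by rewrite take0 f0 mul0r.
case: w wk => [|x w] wk; first by rewrite f0 mul0r.
by rewrite IH ?mulr0 //= size_drop (leq_trans _ wk) // ltnS leq_subr.
Qed.

Lemma sum_iota_stable (G : nat -> int) a b : (a <= b)%N ->
  (forall k, (a <= k)%N -> G k = 0) ->
  \sum_(k <- iota 0 b) G k = \sum_(k <- iota 0 a) G k.
Proof.
move=> ab G0; rewrite -(subnKC ab) iotaD big_cat /= [X in _ + X]big1_seq ?addr0 // => k.
by rewrite mem_iota => /andP[_ /andP[/G0]].
Qed.

(** With e = f - 1, the power e ^ k vanishes on words shorter than k. On each word f ^ n is thus a
    polynomial in n, a combination of binomials, of which only k = 0 survives at n = 0. *)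
Lemma wlim_exp (f : wfun int) : f [::] = 1 -> wlim (fun M => f ^+ M.*2.+1) 1.
Proof.
move=> f1 w; set e := f - 1.
have e0 : e [::] = 0 by rewrite /e wfunD f1 -[(- 1 : wfun int) _]/(-1) subrr.
have h (k : nat) : ilim (fun M => 'C(M.*2.+1, k)%:Z * (e ^+ k) w) ((k == 0%N)%:Z * (e ^+ k) w).
  exact: ilimM (ilim_bin k) (ilim_cst _).
have := @ilim_sum _ (iota 0 (size w).+1) xpredT _ _ h.
have -> : \sum_(k <- iota 0 (size w).+1) (k == 0%N)%:Z * (e ^+ k) w = (1 : wfun int) w.
  by rewrite big_cons mul1r big1_seq ?addr0 // => -[|k]; rewrite ?mem_iota // mul0r.
have fE : f = e + 1 by rewrite subrK.
apply: ilim_ext => M; rewrite [in RHS]fE exprD1n wfun_sum.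
have E (k : nat) : (e ^+ k *+ 'C(M.*2.+1, k)) w = 'C(M.*2.+1, k)%:Z * (e ^+ k) w.
  by rewrite wfunMn pmulrn -mulrzl intz.
under [RHS]eq_bigr do rewrite E.
rewrite -(big_mkord xpredT (fun k => 'C(M.*2.+1, k)%:Z * (e ^+ k) w)) /index_iota subn0.
(* The expansion stops at k = 2M + 1, the polynomial at k = [size w]; the terms in excess vanish, as
   powers of e or as binomials. *)
case: (leqP (size w) M.*2.+1) => hs.
  by apply/esym/sum_iota_stable => // k wk; rewrite wexp_small ?mulr0.
by apply: sum_iota_stable => [|k wk]; rewrite ?ltnS 1?ltnW // bin_small ?mul0r.
Qed.

Lemma wlim_block_fun : wlim block_fun limit_fun.
Proof.
have c1 : zeros_fun [::] = 1 by [].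
(* [M] has to enter through 2M + 1 alone, hence Z^(2M) is written as Z^(2M+1) * Z^-1. *)
have E M : block_fun M = zeros_fun * (run true true * zeros_fun ^+ M.*2.+1 * run true false)
    * (zeros_fun ^+ M.*2.+1 * size_twist zeros_fun).
  by rewrite block_funE exprSr -[_ * zeros_fun * size_twist zeros_fun]mulrA zeros_funV mulr1.
have c2 := wlim_exp c1.
have := wlimM (wlimM (wlim_cst zeros_fun) (wlimM (wlimM (wlim_cst (run true true)) c2)
  (wlim_cst (run true false)))) (wlimM c2 (wlim_cst (size_twist zeros_fun))).
by rewrite mulr1 mul1r => h w; apply: ilim_ext (h w) => M; rewrite E.
Qed.

Lemma wlim_parts F f e : wlim F f -> wlim (fun M => parts (F M) e) (parts f e).
Proof.
move=> h; elim: e => [|a e IH].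
  by move=> w; rewrite /parts big_nil; apply: ilim_ext (ilim_cst _) => M; rewrite big_nil.
have ha : wlim (fun M => part a (F M)) (part a f).
  by move=> w; rewrite /part; case: ifP => _; [exact: h | exact: ilim_cst].
move=> w; rewrite /parts big_cons; apply: ilim_ext (wlimM ha IH w) => M.
by rewrite /parts big_cons.
Qed.

Definition subst_block (M : nat) : pseries -> pseries := subst_letters (signs M).

(** Coefficientwise, so the denominator may depend on [m]. *)
Definition Lim (f g : pseries) : Prop := forall m, ilim (fun M => subst_block M f m) (g m).

Lemma Lim_word_series w : Lim (word_series chain_fun w) (word_series limit_fun w).
Proof.
move=> m; apply: ilim_ext (wlim_parts (expts m) wlim_block_fun w) => M.
by rewrite /subst_block subst_word_series // size_signs.
Qed.

Lemma LimM f f' g g' : Lim f g -> Lim f' g' -> Lim (f * f') (g * g').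
Proof.
move=> h h' m; pose T (p q : mono) M := subst_block M f p * subst_block M f' q.
have hT p q : ilim (T p q) (g p * g' q) by exact: ilimM.
have := @ilim_sum _ (facs m) xpredT _ _ (fun p =>
  @ilim_sum _ (facs m) (fun q => mmul p q == m) _ _ (hT p)).
apply: ilim_ext => M; rewrite /subst_block /subst_letters transferM //.
Qed.

Lemma LimD f f' g g' : Lim f g -> Lim f' g' -> Lim (f + f') (g + g').
Proof.
move=> h h' m; apply: ilim_ext (ilimD (h m) (h' m)) => M.
by rewrite /subst_block /subst_letters transferD.
Qed.

Lemma LimMz f g c : Lim f g -> Lim (f *~ c) (g *~ c).
Proof.
move=> h m; rewrite psMz mulrzz; apply: ilim_ext (ilimM (h m) (ilim_cst c)) => M.
by rewrite /subst_block substMz psMz mulrzz.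
Qed.

Lemma Lim0 : Lim 0 0.
Proof. by have := LimMz 0 (Lim_word_series [::]); rewrite !mulr0z. Qed.

Lemma Lim1 : Lim 1 1.
Proof.
move=> m; apply: ilim_ext (ilim_cst _) => M.
by rewrite /subst_block /subst_letters transfer1.
Qed.

(** * Enriched partitions of a chain *)

(** Labels increase inside a block and drop after it, hence the flag [true] on its last letter; a
    zero has a smaller label than all that follows it. *)
Definition chain_word (al : seq nat) : word :=
  flatten [seq (if a is s.+1 then rcons (nseq s (true, false)) (true, true)
                else [:: (false, false)]) | a <- al].

(** The contribution of the elements sent to the value of code [c] (see [codes]): a negative value
    requires descents, a positive one ascents. *)
Definition steadyx (c : nat) : wfun pseries := fun w =>
  if steady (~~ odd c) w then \prod_(x <- w) xvar c./2 x.1 else 0.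

(* The value -(k+1) has code 2k and the value k+1 has code 2k + 1, so that codes are
   ordered as the values are. A value may be repeated on the next letter iff the
   label moves in the direction prescribed by the parity of the code. *)
Fixpoint codes (n c : nat) (w : word) : seq (seq nat) :=
  if w is x :: w' then
    [seq c' :: s | c' <- iota c (n - c), s <- codes n (c' + (x.2 == odd c')) w']
  else [:: [::]].

Definition codew (s : seq nat) (w : word) : mono :=
  \big[mmul/mone]_(p <- zip s w) mvar p.1./2 p.2.1.

Lemma wder_steadyx c x : wder x (steadyx c) =
  wscale (xvar c./2 x.1) (if x.2 == odd c then 1 else steadyx c).
Proof.
apply: funext => w; rewrite /wder wscaleE /steadyx /=; case: w => [|y w].
  by rewrite big_seq1; case: ifP => _ /=; rewrite ?big_nil mulr1.
rewrite -[(y :: w) == [::]]/false orFb big_cons.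
case: x.2 => /=; case: (odd c) => /=; rewrite ?mulr0 //; by case: ifP; rewrite ?mulr0.
Qed.

Lemma prod_steadyx n c w :
  (\prod_(c <= i < n) steadyx i) w = \sum_(s <- codes n c w) mons (codew s w).
Proof.
elim: w c => [|x w IHw] c /=.
  rewrite big_seq1 /codew /= big_nil mons1.
  elim: (index_iota c n) => [|i r IH]; first by rewrite big_nil.
  by rewrite big_cons wfunM_nil IH mulr1 /steadyx /= big_nil.
move En: (n - c)%N => d; elim: d c En => [|d IHd] c En.
  by rewrite big_geq ?big_nil // -subn_eq0 En.
have cn : (c < n)%N by rewrite -subn_gt0 En.
rewrite big_ltn // wfunM_cons wder_steadyx wscaleAl wscaleE big_allpairs_dep big_cons.
have := IHd c.+1; rewrite subnS En big_allpairs_dep => <- //.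
rewrite addrC; congr (_ + _); last by rewrite /steadyx /= big_nil mul1r.
have -> : ((if x.2 == odd c then 1 else steadyx c) * \prod_(c.+1 <= i < n) steadyx i) w
    = (\prod_(c + (x.2 == odd c) <= i < n) steadyx i) w.
  by case: ifP => _; rewrite ?mul1r ?addn1 // addn0 [in RHS]big_ltn.
rewrite IHw mulr_sumr; apply: eq_bigr => s _.
by rewrite monsM /codew /= big_cons.
Qed.

Definition agree (f g : wfun pseries) : Prop := forall w, valid w -> f w = g w.

Lemma agreeM f f' g g' : agree f f' -> agree g g' -> agree (f * g) (f' * g').
Proof.
move=> ff' gg' w vw; rewrite !wfunM; apply: eq_bigr => k _.
by rewrite ff' ?gg' //; [apply: drop_sorted | apply: take_sorted].
Qed.

Lemma prod_xvar i x w : \prod_(y <- x :: w) xvar i (nat_of_bool y.1) = xvar i (deg (x :: w)).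
Proof.
elim: w x => [|y w IH] x; first by rewrite big_seq1 /deg /= addn0.
by rewrite big_cons IH -xvarM.
Qed.

Lemma marked_steady c : agree (marked (xvar c./2)
  (run (~~ odd c) (~~ odd c) * run (odd c) (~~ odd c))) (steadyx c).
Proof.
move=> w vw; have E := run_steady (~~ odd c) vw; rewrite negbK in E.
case: w vw E => [|x w] vw E.
  by rewrite /steadyx /= big_nil; apply: marked_nil.
apply: etrans (marked_ne _ _ _) _ => //; rewrite E /steadyx prod_xvar.
by case: (steady _ _).
Qed.

(** Each variable splits into its negative and its positive value, in the middle of [zeros_fun]. *)
Lemma prod_marked_chain_fun A :
  agree (\prod_(i < A) marked (xvar i) chain_fun) (\prod_(0 <= c < A.*2) steadyx c).
Proof.
elim: A => [|A IH]; first by rewrite big_ord0 big_geq.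
have -> : \prod_(i < A.+1) marked (xvar i) chain_fun = (\prod_(i < A) marked (xvar i) chain_fun) *
    (marked (xvar A) (run true true * run false true) *
     marked (xvar A) (run false false * run true false)).
  by rewrite big_ord_recr -(markedM (xvarM A)) /chain_fun /zeros_fun !mulrA.
rewrite doubleS !big_nat_recr //= -mulrA; apply: agreeM => //.
have := agreeM (@marked_steady A.*2) (@marked_steady A.*2.+1).
by rewrite /= odd_double /= doubleK uphalf_double.
Qed.

Lemma word_series_codes A w m : valid w -> below A m ->
  word_series chain_fun w m = (count (fun s => codew s w == m) (codes A.*2 0 w))%:R.
Proof.
move=> vw mA; rewrite -(word_series_prod _ _ mA) // prod_marked_chain_fun // prod_steadyx ps_sum.
rewrite -sum1_count natr_sum [RHS]big_mkcond; apply: eq_bigr => s _.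
by rewrite /mons eq_sym; case: eqP.
Qed.

Fixpoint okcode (n c : nat) (s : seq nat) (w : word) : bool :=
  match s, w with
  | a :: s', x :: w' => (c <= a < n)%N && okcode n (a + (x.2 == odd a)) s' w'
  | [::], [::] => true
  | _, _ => false
  end.

Lemma mem_codes n c w s : (s \in codes n c w) = okcode n c s w.
Proof.
elim: w c s => [|x w IH] c [|a s] //=.
  by apply/allpairsPdep => -[? [? []]].
have E : (c <= a < n)%N = (a \in iota c (n - c)).
  rewrite mem_iota; case: (leqP c n) => [cn|nc]; first by rewrite subnKC.
  rewrite (eqP (ltnW nc : n - c == 0)%N) addn0.
  apply/idP/idP => /andP[ca an]; have := leq_ltn_trans ca an; last by rewrite ltnn.
  by rewrite ltnNge (ltnW nc).
rewrite E; apply/allpairsPdep/andP => [[b [t [bi ti [-> ->]]]]|[ai si]].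
  by rewrite bi -IH.
by exists a, s; rewrite ai IH.
Qed.

Lemma uniq_codes n c w : uniq (codes n c w).
Proof.
elim: w c => [|x w IH] c //=; apply: allpairs_uniq_dep => [|a _|].
- exact: iota_uniq.
- exact: IH.
by move=> [a s] [b t] _ _ /= [-> ->].
Qed.

(** Enriched partitions of a chain are the sequences of pairs (code, label) that increase for this
    relation. It is transitive, so comparing neighbours suffices. *)
Definition code_lt (p q : nat * nat) : bool :=
  (p.1 < q.1)%N || ((p.1 == q.1) && (if odd p.1 then p.2 < q.2 else q.2 < p.2)%N).

Lemma code_lt_trans : transitive code_lt.
Proof.
move=> [b y] [a x] [c z]; rewrite /code_lt /=.
case/orP=> [ab|/andP[/eqP-> xy]]; case/orP=> [bc|/andP[/eqP<- yz]].
- by rewrite (ltn_trans ab bc).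
- by rewrite ab.
- by rewrite bc.
rewrite eqxx ltnn /=; move: xy yz; case: (odd b); first exact: ltn_trans.
by move=> yx zy; exact: ltn_trans zy yx.
Qed.

(** [w] describes the chain with labels [C], where labels above [l0] are weighted; the last flag is
    left free. *)
Fixpoint adjoined (l0 : nat) (C : seq nat) (w : word) : bool :=
  match C, w with
  | l :: C', x :: w' =>
      [&& x.1 == (l0 < l)%N,
          (if C' is l' :: _ then (if x.2 then l' < l else l < l')%N else true)
        & adjoined l0 C' w']
  | [::], [::] => true
  | _, _ => false
  end.

(** The flags record the label comparisons of [code_lt], so adding 1 to the lower bound excludes
    exactly the forbidden repetitions of a code. *)
Lemma okcode_lt l0 C w n c s : adjoined l0 C w -> okcode n c s w =
  [&& size s == size C, (if s is a :: _ then c <= a else true)%N, all (fun a => a < n)%N s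
    & sorted code_lt (zip s C)].
Proof.
elim: w c s C => [|x w IH] c [|a s] [|l C] //= /and3P[_ xl aw].
rewrite (IH _ _ C) // eqSS.
case: eqP => [sC|_]; last by rewrite ?andbF.
  case: s C sC xl {IH aw} => [|b s] [|l' C] //= _ xl; first by rewrite !andbT.
  rewrite [code_lt _ _]/code_lt /=.
  have -> : (a + (x.2 == odd a) <= b)%N =
      (a < b)%N || (a == b) && (if odd a then l < l' else l' < l)%N.
    move: xl; case: x.2 => ll; have gg : (_ < _)%N = false := leq_gtF (ltnW ll);
      case: (odd a); rewrite ?addn1 ?addn0 ?ll ?gg ?andbT ?andbF ?orbF //.
      by rewrite leq_eqVlt orbC.
    by rewrite leq_eqVlt orbC.
  by rewrite -!andbA; congr (_ && (_ && _)); rewrite andbCA; congr (_ && _); rewrite andbCA.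
Qed.

Lemma adjoined_valid l0 C w : adjoined l0 C w -> valid w.
Proof.
elim: C w => [|l C IH] [|x w] // /and3P[/eqP xl lw aw]; have vw := IH _ aw.
case: C w aw lw vw {IH} => [|l' C] [|y w] // /and3P[/eqP yl _ _] lw vw.
by apply/andP; split=> //=; rewrite xl yl; move: lw; case: x.2; lia.
Qed.

Lemma ell0_cons a al : ell0 (a :: al) = ((a == 0%N) + ell0 al)%N.
Proof. by []. Qed.

(** The hypothesis keeps the labels of the remaining zeros, counted from [c], at most [l0], hence
    below those of the blocks. *)
Lemma chain_from_bounds l0 c al x : (c + ell0 al <= l0.+1)%N ->
  x \in chain_from l0 c al -> (c <= x <= l0 + sumn al)%N.
Proof.
elim: al c => [|[|s] al IH] c //; rewrite ell0_cons /= => cl.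
  have h : (c.+1 + ell0 al <= l0.+1)%N by lia.
  by rewrite in_cons => /orP[/eqP->|/(IH _ h)]; lia.
have h : (c + ell0 al <= l0.+1)%N by lia.
by rewrite in_cons mem_cat mem_iota => /or3P[/eqP->||/(IH _ h)]; lia.
Qed.

Lemma uniq_chain_from l0 c al : (c + ell0 al <= l0.+1)%N -> uniq (chain_from l0 c al).
Proof.
elim: al c => [|[|s] al IH] c //; rewrite ell0_cons => cl.
  have h : (c.+1 + ell0 al <= l0.+1)%N by lia.
  rewrite /= IH // andbT; apply/negP => /(chain_from_bounds h); lia.
have h : (c + ell0 al <= l0.+1)%N by lia.
rewrite -[chain_from _ _ _]/(iota (l0 + sumn al).+1 s.+1 ++ chain_from l0 c al).
rewrite cat_uniq iota_uniq IH // andbT; apply/hasPn => x /(chain_from_bounds h).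
by rewrite mem_iota; lia.
Qed.

Lemma adjoined_block l0 s b C w : (l0 < b)%N -> adjoined l0 C w ->
  (if C is l' :: _ then l' < b else true)%N ->
  adjoined l0 (iota b s.+1 ++ C) (rcons (nseq s (true, false)) (true, true) ++ w).
Proof.
move=> + aw; elim: s b => [|s IH] b lb Cb.
  by rewrite /= lb aw; case: C {aw} Cb => //= l' C ->.
have := IH b.+1 (leqW lb); rewrite -[iota b s.+2 ++ C]/(b :: iota b.+1 s.+1 ++ C) /= lb => -> //.
  by rewrite ltnS leqnn.
by case: C Cb {aw IH} => // l' C /leqW.
Qed.

Lemma adjoined_chain l0 c al : (c + ell0 al <= l0.+1)%N ->
  adjoined l0 (chain_from l0 c al) (chain_word al).
Proof.
elim: al c => [|[|s] al IH] c //; rewrite ell0_cons => cl.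
  have h : (c.+1 + ell0 al <= l0.+1)%N by lia.
  apply/and3P; split; [by apply/eqP; rewrite /=; lia | | exact: IH].
  rewrite -/(chain_from l0 c.+1 al).
  have := @chain_from_bounds l0 c.+1 al; case: (chain_from _ _ _) => // l' C.
  by move=> /(_ l' h (mem_head _ _)) /=; lia.
have h : (c + ell0 al <= l0.+1)%N by lia.
apply: (@adjoined_block l0 s (l0 + sumn al).+1); [lia | exact: IH |].
rewrite -/(chain_from l0 c al).
have := @chain_from_bounds l0 c al; case: (chain_from _ _ _) => // l' C.
by move=> /(_ l' h (mem_head _ _)); lia.
Qed.

Lemma size_adjoined l0 C w : adjoined l0 C w -> size C = size w.
Proof. by elim: C w => [|l C IH] [|x w] //= /and3P[_ _ /IH->]. Qed.

Definition code (u : nat * bool) : nat := (u.1.*2 + u.2)%N.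

Lemma code_half u : (code u)./2 = u.1.
Proof. by case: u => k b; rewrite /code halfD odd_double doubleK /=; case: b; rewrite addn0. Qed.

Lemma code_odd u : odd (code u) = u.2.
Proof. by case: u => k b; rewrite /code oddD odd_double /=; case: b. Qed.

Lemma code_inj : injective code.
Proof.
move=> u v E; have := code_half u; have := code_odd u; rewrite E code_half code_odd.
by case: u v {E} => [k b] [k' b'] /= -> ->.
Qed.

Lemma abs_signed u : `|signed u|%N = u.1.+1.
Proof. by case: u => k [] //=; rewrite /signed abszN. Qed.

Lemma enriched_code u v l l' :
  [&& preceq (signed u) (signed v),
      ((signed u == signed v) && (0 < signed u)) ==> (l < l')%N
    & ((signed u == signed v) && (signed u < 0)) ==> (l' < l)%N]
  = code_lt (code u, l) (code v, l').
Proof.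
rewrite /code_lt /= code_odd /preceq !abs_signed.
case: u v => [k b] [k' b']; rewrite /signed /code /=.
by case: b; case: b'; case: ltngtP => kk /=; lia.
Qed.

Lemma pairwise_index (T : eqType) (R : rel T) (s : seq T) : uniq s ->
  reflect {in s &, forall u v, (index u s < index v s)%N -> R u v} (pairwise R s).
Proof.
case: s => [|x0 s] us; first by left.
apply: (iffP (pairwiseP x0)) => h => [u v us' vs' uv | i j iv jv ij].
  have gtnP x : x \in x0 :: s -> index x (x0 :: s) \in gtn (size (x0 :: s)).
    by rewrite -index_mem.
  by have := h _ _ (gtnP u us') (gtnP v vs') uv; rewrite !nth_index.
by apply: h; rewrite ?mem_nth // !index_uniq.
Qed.

Lemma map_nth_index (T : eqType) (S : Type) (x0 : S) (s : seq S) (r : seq T) :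
  uniq r -> size s = size r -> [seq nth x0 s (index v r) | v <- r] = s.
Proof.
move=> ur sr; apply: (@eq_from_nth _ x0); first by rewrite size_map.
rewrite size_map => i ir; case: r ur sr ir => // v0 r ur sr ir.
by rewrite (nth_map v0) // index_uniq.
Qed.

Section LambdaChain.
Variables (l0 : nat) (C : seq nat) (w : word) (m : mono).
Hypotheses (uC : uniq C) (aC : adjoined l0 C w).

Let P : {fset nat} := [fset x in C]%fset.

Let vs : seq P := pmap insub C.

Let val_vs : map val vs = C.
Proof.
rewrite /vs; have : all (fun x => x \in P) C by apply/allP => x; rewrite inE.
by elim: (C) => //= x r IH /andP[xP /IH]; rewrite insubT /= => ->.
Qed.

Let uvs : uniq vs.
Proof. by rewrite -(map_inj_uniq val_inj) val_vs. Qed.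

Let mem_vs v : v \in vs.
Proof. by rewrite -(mem_map val_inj) val_vs; have := valP v; rewrite inE. Qed.

Let size_vs : size vs = size C.
Proof. by rewrite -val_vs size_map. Qed.

Let fcode (f : {ffun P -> finsupp m * bool}) (v : P) : nat := code (val (f v).1, (f v).2).

Let fcodes f := [seq fcode f v | v <- vs].

Let r (f : {ffun P -> finsupp m * bool}) (u v : P) :=
  code_lt (fcode f u, val u) (fcode f v, val v).

Let index_vs v : index (val v) C = index v vs.
Proof. by rewrite -val_vs index_map //; exact: val_inj. Qed.

Let enriched_codes (f : {ffun P -> finsupp m * bool}) :
  enriched (fun x y => (index x C < index y C)%N)
    (fun v : P => signed (val (f v).1, (f v).2)) = sorted code_lt (zip (fcodes f) C).
Proof.
have -> : zip (fcodes f) C = [seq (fcode f v, val v) | v <- vs].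
  by rewrite -[in LHS]val_vs zip_map.
rewrite (sorted_pairwise code_lt_trans) pairwise_map.
apply/forallP/(pairwise_index _ uvs) => [h u v _ _ uv | h u].
  have /forallP/(_ v)/implyP := h u.
  by rewrite enriched_code !index_vs; apply.
apply/forallP => v; apply/implyP; rewrite enriched_code !index_vs => uv.
exact: h.
Qed.

Let codew_adjoined s : size s = size C ->
  codew s w = \big[mmul/mone]_(p <- zip s C) mvar p.1./2 (l0 < p.2)%N.
Proof.
move=> sC; rewrite /codew; elim: (C) (w) s aC sC => [|l C' IH] [|x w'] [|a s] //=.
  by rewrite !big_nil.
move=> /and3P[/eqP xl _ aw] [sC]; rewrite !big_cons /= xl; congr (mmul _ _).
exact: IH.
Qed.

Let weight_codes (f : {ffun P -> finsupp m * bool}) :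
  weight [fset x in C | (l0 < x)%N]%fset (fun v : P => signed (val (f v).1, (f v).2))
    = codew (fcodes f) w.
Proof.
rewrite codew_adjoined ?size_map // -[in RHS]val_vs zip_map big_map /weight.
rewrite [LHS](perm_big vs) /=; last first.
  by apply: uniq_perm; rewrite ?index_enum_uniq // => v; rewrite mem_index_enum mem_vs.
apply: eq_bigr => v _; rewrite abs_signed /fcode code_half /=; congr mvar.
by rewrite !inE /=; have := valP v; rewrite inE => ->.
Qed.

Let codew_mem s a : size s = size w -> a \in s -> codew s w a./2 != None.
Proof.
rewrite /codew; elim: (w) s => [|x w' IH] [|b s] //= [sw].
rewrite in_cons big_cons mmulE mvarE => /orP[/eqP->|/(IH _ sw)].
  by rewrite eqxx; case: (X in oadd _ X).
by case: (X in oadd _ X) => [c|]; case: (X in oadd X _) => [d|].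
Qed.

(** Reading the codes along the chain is a bijection from the counted partitions to the code
    sequences of weight [m]; [n] bounds the codes of the variables of [m]. *)
Lemma Lambda_codes (n : nat) : (forall k, k \in finsupp m -> (k.*2.+1 < n)%N) ->
  @Lambda P (fun x y => (index x C < index y C)%N) [fset x in C | (l0 < x)%N]%fset m
    = (count (fun s => codew s w == m) (codes n 0 w))%:R.
Proof.
move=> mn; rewrite /Lambda; congr (_%:R).
have sw : size w = size C by rewrite (size_adjoined aC).
rewrite -size_filter cardE.
rewrite -(size_map fcodes); apply: perm_size; apply: uniq_perm.
- rewrite map_inj_uniq ?enum_uniq // => f g E; apply/ffunP => v.
  have : fcode f v = fcode g v by have /eq_in_map := E; apply.
  move/code_inj => -[]; case: (f v) (g v) => [a b] [a' b'] /= Ea ->.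
  by congr (_, _); apply: val_inj.
- by rewrite filter_uniq ?uniq_codes.
move=> s; rewrite mem_filter mem_codes (okcode_lt _ _ _ aC); apply/mapP/andP.
  move=> [f]; rewrite mem_enum inE enriched_codes weight_codes => /andP[sf wf] ->.
  rewrite wf size_map size_vs eqxx sf andbT /=; split=> //; apply/andP; split.
    by case: (fcodes f).
  apply/allP => a /mapP[v _ ->]; rewrite /fcode /code /=.
  by apply: leq_ltn_trans (mn _ (valP (f v).1)); rewrite -addn1 leq_add2l; case: (f v).2.
move=> [/eqP ws /and4P[/eqP sC _ _ ss]].
(* As [m] is the weight, the variable of each code occurs in [m], so the code is that of a value
   allowed by [Lambda]. *)
have [f fE] : exists f : forall v : P, finsupp m * bool,
    forall v, code (val (f v).1, (f v).2) = nth 0%N s (index v vs).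
  apply: (@fin_all_exists _ _ (fun v u => code (val u.1, u.2) = nth 0%N s (index v vs))).
  move=> v; set a := nth _ _ _.
  have ia : a \in s by rewrite mem_nth // sC -size_vs index_mem.
  have am : a./2 \in finsupp m by rewrite mem_finsupp -ws codew_mem // sC.
  exists ([` am]%fset, odd a); rewrite /code /=.
  by rewrite addnC odd_double_half.
have sE : s = fcodes [ffun v => f v].
  rewrite -(map_nth_index 0%N uvs (_ : size s = size vs)) ?size_vs //.
  by apply: eq_map => v; rewrite /fcode ffunE fE.
exists [ffun v => f v]; last exact: sE.
by rewrite mem_enum inE enriched_codes weight_codes -sE ss ws eqxx.
Qed.

End LambdaChain.

Lemma K_word_series al : K al = word_series chain_fun (chain_word al).
Proof.
apply: funext => m; have [A mA] := below_ex m.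
have h : (1 + ell0 al <= (ell0 al).+1)%N by [].
have aC : adjoined (ell0 al) (chain al) (chain_word al) := adjoined_chain h.
rewrite (word_series_codes (adjoined_valid aC) mA).
apply: Lambda_codes => //; first exact: uniq_chain_from h.
move=> k; rewrite mem_finsupp; case: (ltnP k A) => [kA _|/mA->//].
by rewrite -doubleS leq_double.
Qed.

(** * Coproduct and antipode *)

Lemma part_nil a f : part a f [::] = 0.
Proof. by []. Qed.

Lemma parts_nil f e : parts f e [::] = (e == [::])%:R.
Proof.
case: e => [|a e]; rewrite /parts ?big_nil ?wfun1 //.
by rewrite big_cons wfunM_nil part_nil mul0r.
Qed.

Lemma word_series_nil f : word_series f [::] = 1.
Proof. by apply: funext => m; rewrite /word_series parts_nil expts_eq0. Qed.

Lemma counit_word_series f w : counit (word_series f w) = (w == [::])%:R.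
Proof.
rewrite /counit /word_series; have /eqP-> : expts mone == [::] by rewrite expts_eq0.
by rewrite /parts big_nil wfun1.
Qed.

Lemma ps2_sum I (r : seq I) (P : pred I) (F : I -> pseries2) pq :
  (\sum_(i <- r | P i) F i) pq = \sum_(i <- r | P i) F i pq.
Proof. exact: (big_morph (fun f : pseries2 => f pq)). Qed.

Lemma ps2Mz (f : pseries2) c pq : (f *~ c) pq = f pq *~ c.
Proof.
have H n : (f *+ n) pq = f pq *+ n by elim: n => // n IH; rewrite !mulrS -IH.
case: c => n; first exact: H.
by rewrite !NegzE !mulrNz -[LHS]/(- ((f *+ n.+1) pq)) H.
Qed.

Lemma Delta_word_series f w :
  Delta (word_series f w) =
    \sum_(k < (size w).+1) tens (word_series f (take k w)) (word_series f (drop k w)).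
Proof.
apply: funext => -[p q]; rewrite ps2_sum /Delta /word_series expts_std parts_cat wfunM.
by [].
Qed.

(** A finite list with every [e] such that [parts f e w] is nonzero; it makes a word series a finite
    combination of the [M e]. *)
Fixpoint parts_support (n : nat) (w : word) : seq (seq nat) :=
  if n is n'.+1 then
    [::] :: [seq deg (take k w) :: e | k <- iota 1 (size w), e <- parts_support n' (drop k w)]
  else [:: [::]].

Lemma parts_supportP f n w e : (size w <= n)%N ->
  parts f e w != 0 -> e \in parts_support n w.
Proof.
elim: n w e => [|n IH] w e wn.
  by rewrite (size0nil (eqP _ : size w = 0%N)) -?leqn0 // parts_nil; case: e.
case: e => [_|a e]; first exact: mem_head.
rewrite in_cons /= => nz; apply/allpairsPdep.
have [k [nzk kw]] : exists k, parts f e (drop k w) != 0 /\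
    [/\ (k <= size w)%N, take k w != [::] & deg (take k w) == a].
  apply: contra_neqP nz => h; rewrite /parts big_cons wfunM big1 // => k _.
  rewrite -/(parts f e) /part; case: ifP => [/andP[tk dk]|_]; last by rewrite mul0r.
  apply/eqP; rewrite mulf_eq0; apply/orP; right; apply/negPn/negP => hk.
  by apply: h; exists k; rewrite hk -ltnS ltn_ord.
have [kn tk /eqP <-] := kw; have k0 : (0 < k)%N by case: k tk {kw kn nzk}; rewrite ?take0.
exists k, e; split=> //; first by rewrite mem_iota k0 add1n ltnS.
by apply: IH => //; rewrite size_drop; lia.
Qed.

Section Span.
Variables (D : {pred seq nat}) (F : seq nat -> pseries).

Lemma zspan_gen al : al \in D -> F al \in zspan D F.
Proof.
move=> alD; apply/asboolP; exists [:: (1, al)]; first by rewrite /= alD.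
by rewrite big_seq1.
Qed.

Lemma zspan_lin c f g : f \in zspan D F -> g \in zspan D F -> f *~ c + g \in zspan D F.
Proof.
move=> /asboolP[s sD ->] /asboolP[t tD ->]; apply/asboolP.
exists ([seq (x.1 * c, x.2) | x <- s] ++ t); first by rewrite all_cat all_map tD andbT.
rewrite big_cat big_map /=; congr (_ + _); rewrite mulrz_suml.
by apply: eq_bigr => x _; rewrite mulrzA.
Qed.

Lemma zspan0 : 0 \in zspan D F.
Proof. by apply/asboolP; exists [::]; rewrite ?big_nil. Qed.

Lemma zspanMz c f : f \in zspan D F -> f *~ c \in zspan D F.
Proof. by move=> fD; rewrite -[_ *~ _]addr0 zspan_lin // zspan0. Qed.

Lemma zspan_ind (Q : pseries -> Prop) :
  Q 0 -> (forall al, al \in D -> Q (F al)) ->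
  (forall c f g, f \in zspan D F -> g \in zspan D F -> Q f -> Q g -> Q (f *~ c + g)) ->
  forall f, f \in zspan D F -> Q f.
Proof.
move=> Q0 QF Qlin f /asboolP[s sD ->].
suff [] : Q (\sum_(c <- s) F c.2 *~ c.1) /\ \sum_(c <- s) F c.2 *~ c.1 \in zspan D F by [].
elim: s sD => [_|[c al] s IH /= /andP[alD /IH[Qs sD]]].
  by rewrite big_nil; split=> //; exact: zspan0.
rewrite big_cons /=; split; last by apply: zspan_lin => //; exact: zspan_gen.
by apply: Qlin => //; [exact: zspan_gen | exact: QF].
Qed.

End Span.

Lemma zspan_sub (D D' : {pred seq nat}) F F' :
  (forall al, al \in D -> F al \in zspan D' F') -> {subset zspan D F <= zspan D' F'}.
Proof.
move=> h; apply: (zspan_ind (Q := fun f => f \in zspan D' F')) => [|//|c f g _ _].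
  exact: zspan0.
exact: zspan_lin.
Qed.

Lemma M_std al e : M al (std e) = (e == al)%:R.
Proof. by rewrite /M expts_std. Qed.

Lemma word_series_WCQSym f w : word_series f w \in WCQSym.
Proof.
apply/asboolP; exists [seq (parts f e w, e) | e <- undup (parts_support (size w) w)].
  by apply/allP.
apply: funext => m; rewrite ps_sum big_map /=.
under eq_bigr do rewrite psMz /M mulrb; rewrite /word_series.
case: (boolP (expts m \in parts_support (size w) w)) => [mS|nS].
  rewrite (bigD1_seq (expts m)) ?undup_uniq ?mem_undup //= eqxx mulrzz mul1r.
  by rewrite big1 ?addr0 // => e; rewrite eq_sym => /negbTE->; rewrite mul0rz.
rewrite big1_seq => [|e /andP[_ eS]].
  by apply/eqP; apply: contraNT nS; apply: parts_supportP.
by case: eqP => [E|_]; rewrite ?mul0rz //; rewrite mem_undup -E (negbTE nS) in eS.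
Qed.

Lemma WPQSym_sub_WCQSym : {subset WPQSym <= WCQSym}.
Proof. by apply: zspan_sub => al _; rewrite K_word_series; exact: word_series_WCQSym. Qed.

Lemma PQSym_sub_WPQSym : {subset PQSym <= WPQSym}.
Proof. by apply: zspan_sub => al _; exact: zspan_gen. Qed.

Section Antipode.
Variable S : pseries -> pseries.
Hypothesis hS : is_antipode S.

(** The expansion holds over every large enough [X], so that several series can be expanded over one
    common list. *)
Let SM : forall f, f \in WCQSym -> exists X0 : seq (seq nat), forall X,
  uniq X -> {subset X0 <= X} ->
  f = \sum_(e <- X) M e *~ f (std e) /\ S f = \sum_(e <- X) S (M e) *~ f (std e).
Proof.
have [[_ Slin] _] := hS.
have S0 : S 0 = 0.
  have := Slin (-1) 0 0 (zspan0 _ _) (zspan0 _ _).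
  by rewrite mulrN1z oppr0 addr0 mulrN1z addNr.
apply: zspan_ind => [|al _|c f g fW gW [X0 hf] [Y0 hg]].
- by exists [::] => X _ _; rewrite !big1 // => e _; rewrite ps0E mulr0z.
- exists [:: al] => X uX /(_ al (mem_head _ _)) alX.
  have h (G : seq nat -> pseries) : \sum_(e <- X) G e *~ M al (std e) = G al.
    rewrite (bigD1_seq al) //= M_std eqxx mulr1z big1 ?addr0 // => e /negbTE ne.
    by rewrite M_std ne mulr0z.
  by rewrite !h.
exists (X0 ++ Y0) => X uX sX.
have [|Ef Sf] := hf X uX; first by move=> e eX; rewrite sX // mem_cat eX.
have [|Eg Sg] := hg X uX; first by move=> e eX; rewrite sX // mem_cat eX orbT.
have E (G : seq nat -> pseries) : \sum_(e <- X) G e *~ (f *~ c + g) (std e) =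
    (\sum_(e <- X) G e *~ f (std e)) *~ c + \sum_(e <- X) G e *~ g (std e).
  rewrite mulrz_suml -big_split; apply: eq_bigr => e _.
  by rewrite psDE psMz mulrzz mulrzDr mulrzA.
by rewrite !E -Ef -Eg -Sf -Sg; split=> //; apply: Slin.
Qed.

Let take_drop_sum (X : seq (seq nat)) e (G : seq nat -> seq nat -> pseries) :
  uniq X -> (forall k, (k <= size e)%N -> take k e \in X /\ drop k e \in X) ->
  \sum_(a <- X) \sum_(b <- X) G a b *~ M e (std (a ++ b))
    = \sum_(k < (size e).+1) G (take k e) (drop k e).
Proof.
move=> uX eX.
have E a b : M e (std (a ++ b)) =
    \sum_(k < (size e).+1) ((a == take k e)%:R * (b == drop k e)%:R : int).
  have := congr1 (fun F => F (std a, std b)) (Delta_M e).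
  rewrite ps2_sum /Delta /= !expts_std => ->; apply: eq_bigr => k _.
  by rewrite /tens /= !M_std.
under eq_bigr => a _ do under eq_bigr => b _ do rewrite E mulrz_sumr.
under eq_bigr => a _ do rewrite exchange_big.
rewrite exchange_big; apply: eq_bigr => k _ /=.
have [tX dX] := eX k (leq_ord k).
rewrite (bigD1_seq (take k e)) //= [X in _ + X]big1 ?addr0; last first.
  by move=> a /negbTE na; rewrite big1 // => b _; rewrite na mul0r mulr0z.
rewrite (bigD1_seq (drop k e)) //= !eqxx big1 ?addr0; first by rewrite mulr1z.
by move=> b /negbTE nb; rewrite nb mulr0 mulr0z.
Qed.

(** [is_antipode] states the convolution identity for the [M al] only; bilinear expansion carries it
    over to any expression of [Delta f] by tensors from [WCQSym]. *)
Lemma antipode_conv f (s : seq (pseries * pseries)) : f \in WCQSym ->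
  all (fun p => (p.1 \in WCQSym) && (p.2 \in WCQSym)) s ->
  Delta f = \sum_(p <- s) tens p.1 p.2 ->
  \sum_(p <- s) S p.1 * p.2 = (counit f)%:~R.
Proof.
move=> fW sW Df; have [X0 hX0] := SM fW.
have [|Ef _] := hX0 (undup X0) (undup_uniq _); first by move=> e; rewrite mem_undup.
set V := undup X0 in Ef.
have [Y hY] : exists Y : seq (seq nat), forall X, uniq X -> {subset Y <= X} ->
    {in s, forall p, S p.1 = \sum_(e <- X) S (M e) *~ p.1 (std e) /\
                     p.2 = \sum_(e <- X) M e *~ p.2 (std e)}.
  elim: s sW {Df} => [|p s IH] /=; first by exists [::].
  case/andP=> /andP[/SM[X1 h1] /SM[X2 h2]] /IH[Y hY].
  exists (X1 ++ X2 ++ Y) => X uX sX q; rewrite in_cons => /orP[/eqP->|qs].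
    have [|_ E1] := h1 X uX; first by move=> e eX; rewrite sX // mem_cat eX.
    have [|E2 _] := h2 X uX; first by move=> e eX; rewrite sX // !mem_cat eX orbT.
    by [].
  by apply: hY => // e eX; rewrite sX // !mem_cat eX !orbT.
pose X := undup (Y ++ [seq take k e | e <- V, k <- iota 0 (size e).+1]
                   ++ [seq drop k e | e <- V, k <- iota 0 (size e).+1]).
have uX : uniq X := undup_uniq _.
have sYX : {subset Y <= X} by move=> e eY; rewrite mem_undup mem_cat eY.
have {}hY := hY X uX sYX.
have cutX e : e \in V -> forall k, (k <= size e)%N -> take k e \in X /\ drop k e \in X.
  move=> eV k ke; have ki : k \in iota 0 (size e).+1 by rewrite mem_iota.
  by split; rewrite mem_undup !mem_cat; apply/or3P; [apply: Or32 | apply: Or33];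
    apply/allpairsPdep; exists e, k.
have fE a b : f (std (a ++ b)) = \sum_(e <- V) M e (std (a ++ b)) * f (std e).
  by rewrite {1}Ef ps_sum; apply: eq_bigr => e _; rewrite psMz mulrzz.
have cE : counit f = \sum_(e <- V) counit (M e) * f (std e).
  by rewrite {1}Ef /counit ps_sum; apply: eq_bigr => e _; rewrite psMz mulrzz.
transitivity (\sum_(a <- X) \sum_(b <- X) (S (M a) * M b) *~ f (std (a ++ b))).
  transitivity (\sum_(p <- s) \sum_(a <- X) \sum_(b <- X)
      (S (M a) * M b) *~ (p.1 (std a) * p.2 (std b))).
    rewrite big_seq [RHS]big_seq; apply: eq_bigr => p ps.
    have [-> E2] := hY p ps; rewrite {1}E2.
    rewrite mulr_suml; apply: eq_bigr => a _; rewrite mulr_sumr; apply: eq_bigr => b _.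
    by rewrite mulrzAl mulrzAr -mulrzA; congr (_ *~ _); exact: mulrC.
  rewrite exchange_big; apply: eq_bigr => a _; rewrite exchange_big.
  apply: eq_bigr => b _ /=; rewrite -mulrz_sumr; congr (_ *~ _).
  have := congr1 (fun F => F (std a, std b)) Df.
  by rewrite ps2_sum /Delta /= !expts_std.
transitivity (\sum_(e <- V) (counit (M e))%:~R *~ f (std e) : pseries).
  under eq_bigr => a _ do under eq_bigr => b _ do rewrite fE mulrz_sumr.
  under eq_bigr => a _ do rewrite exchange_big.
  rewrite exchange_big big_seq [RHS]big_seq; apply: eq_bigr => e eV /=.
  have [_ /(_ e)[<- _]] := hS.
  rewrite -(take_drop_sum (fun a b => S (M a) * M b) uX (cutX e eV)) mulrz_suml.
  apply: eq_bigr => a _; rewrite mulrz_suml; apply: eq_bigr => b _.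
  by rewrite mulrzA.
rewrite cE rmorph_sum; apply: eq_bigr => e _.
by rewrite rmorphM mulrzr.
Qed.

End Antipode.

Lemma antipode_word_series S f w : is_antipode S ->
  \sum_(k < (size w).+1) S (word_series f (take k w)) * word_series f (drop k w) = (w == [::])%:R.
Proof.
move=> hS.
pose s := [seq (word_series f (take (val k) w), word_series f (drop (val k) w))
             | k <- index_enum 'I_(size w).+1].
have sW : all (fun p => (p.1 \in WCQSym) && (p.2 \in WCQSym)) s.
  by apply/allP => p /mapP[k _ ->]; rewrite !word_series_WCQSym.
have Ds : Delta (word_series f w) = \sum_(p <- s) tens p.1 p.2 by rewrite Delta_word_series big_map.
have := antipode_conv hS (word_series_WCQSym f w) sW Ds; rewrite counit_word_series big_map => ->.
by case: (w == _).
Qed.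

(** In the convolution identity the last cut contributes [S (word_series f w)] itself; the other
    cuts involve shorter prefixes, so that limits pass to [S] by induction. *)
Lemma antipode_word_series_rec S f w : is_antipode S -> S (word_series f w) =
  (w == [::])%:R - \sum_(k < size w) S (word_series f (take k w)) * word_series f (drop k w).
Proof.
move=> /(antipode_word_series f w) <-; rewrite big_ord_recr /=.
rewrite take_size drop_size word_series_nil mulr1.
by rewrite addrC addrK.
Qed.

Lemma Lim_sum (n : nat) (F G : nat -> pseries) : (forall k, (k < n)%N -> Lim (F k) (G k)) ->
  Lim (\sum_(k < n) F k) (\sum_(k < n) G k).
Proof.
elim: n => [|n IH] h; first by rewrite !big_ord0; exact: Lim0.
by rewrite !big_ord_recr /=; apply: LimD; [apply: IH => k kn; apply: h; exact: ltnW | exact: h].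
Qed.

Lemma LimN f g : Lim f g -> Lim (- f) (- g).
Proof. by move=> /(LimMz (-1)); rewrite !mulrN1z. Qed.

Lemma Lim_antipode S w : is_antipode S ->
  Lim (S (word_series chain_fun w)) (S (word_series limit_fun w)).
Proof.
move=> hS; move: {2}(size w) (leqnn (size w)) => n; elim: n w => [|n IH] w wn.
all: rewrite !(antipode_word_series_rec _ w hS); apply: LimD.
all: try by case: (w == _); [exact: Lim1 | exact: Lim0].
all: apply: LimN; apply: (@Lim_sum _
  (fun k => S (word_series chain_fun (take k w)) * word_series chain_fun (drop k w))
  (fun k => S (word_series limit_fun (take k w)) * word_series limit_fun (drop k w))) => k kw.
  by move: wn kw; lia.
apply: LimM; last exact: Lim_word_series.
by apply: IH; rewrite size_take kw; move: wn kw; lia.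
Qed.

(** Defined on all series, without choosing an expression in the [K al]. On [WPQSym] the limits
    exist by [Lim_rho]; 0 is the default elsewhere. *)
Definition rho (f : pseries) : pseries := fun m =>
  if pselect (exists c, ilim (fun M => subst_block M f m) c) is left h then sval (cid h) else 0.

Lemma rho_eq f g : Lim f g -> rho f = g.
Proof.
move=> h; apply: funext => m; rewrite /rho; case: pselect => [e|[]]; last by exists (g m).
by apply: ilim_unique (h m); case: (cid e).
Qed.

Lemma deg0_zeros d w : deg w != 0%N -> isrun false d w = false.
Proof. by move=> dw; apply/negP => /isrun_deg; apply/eqP. Qed.

(** * The limit series *)

Definition on_zeros (f : wfun int) : Prop := forall w, deg w != 0%N -> f w = 0.

Lemma on_zerosM f g : on_zeros f -> on_zeros g -> on_zeros (f * g).
Proof.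
move=> f0 g0 w dw; rewrite wfunM; apply: big1 => k _.
case: (eqVneq (deg (take k w)) 0%N) => [dt|/f0->]; last by rewrite mul0r.
rewrite [g _]g0 ?mulr0 //; apply: contraNneq dw => dd.
by rewrite -(cat_take_drop k w) deg_cat dt dd.
Qed.

Lemma zeros_fun_on_zeros : on_zeros zeros_fun.
Proof. by apply: on_zerosM => w dw; rewrite /run deg0_zeros. Qed.

Lemma size_twist_on_zeros f : on_zeros f -> on_zeros (size_twist f).
Proof. by move=> f0 w /f0; rewrite /size_twist /twist => ->; rewrite mulr0. Qed.

Definition grade (a : nat) (f : wfun int) : wfun int :=
  fun w => if deg w == a then f w else 0.

(** Subtracting 1 expresses the test for nonempty words by a ring operation, which conjugation
    respects. *)
Lemma part_grade a (f : wfun int) : f [::] = 1 -> part a f = grade a (f - 1).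
Proof.
move=> f1; apply: funext => w; rewrite /part /grade wfunD.
rewrite -[(- 1 : wfun int) w]/(- (w == [::])%:R).
case: w => [|x w] /=; last by rewrite subr0.
by rewrite f1 subrr if_same.
Qed.

Lemma grade_mull a (c f : wfun int) : on_zeros c -> grade a (c * f) = c * grade a f.
Proof.
move=> c0; apply: funext => w; rewrite [RHS]wfunM.
transitivity (\sum_(k < (size w).+1)
    if deg w == a then c (take k w) * f (drop k w) else 0).
  by rewrite /grade wfunM; case: ifP => // _; rewrite big1.
apply: eq_bigr => k _; rewrite /grade.
case: (eqVneq (deg (take k w)) 0%N) => [dt|/c0->]; last by rewrite !mul0r if_same.
rewrite -{1}(cat_take_drop k w) deg_cat dt add0n.
by case: ifP; rewrite ?mulr0.
Qed.

Lemma grade_mulr a (c f : wfun int) : on_zeros c -> grade a (f * c) = grade a f * c.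
Proof.
move=> c0; apply: funext => w; rewrite [RHS]wfunM.
transitivity (\sum_(k < (size w).+1)
    if deg w == a then f (take k w) * c (drop k w) else 0).
  by rewrite /grade wfunM; case: ifP => // _; rewrite big1.
apply: eq_bigr => k _; rewrite /grade.
case: (eqVneq (deg (drop k w)) 0%N) => [dt|/c0->]; last by rewrite !mulr0 if_same.
rewrite -{1}(cat_take_drop k w) deg_cat dt addn0.
by case: ifP; rewrite ?mul0r.
Qed.

Definition ones_fun : wfun int := run true true * run true false.

(** [zeros_fun] and its inverse contribute no ones, so taking the part with [a] ones commutes with
    conjugation; in the product over [e] the inner conjugating factors cancel. *)
Lemma parts_limit_fun e :
  parts limit_fun e = zeros_fun * parts ones_fun e * size_twist zeros_fun.
Proof.
have szc0 := size_twist_on_zeros zeros_fun_on_zeros.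
elim: e => [|a e IH]; first by rewrite /parts !big_nil mulr1 zeros_funV.
rewrite /parts !big_cons -!/(parts _ _) IH.
have -> : part a limit_fun = zeros_fun * part a ones_fun * size_twist zeros_fun.
  rewrite !part_grade // -(grade_mull _ _ zeros_fun_on_zeros) -(grade_mulr _ _ szc0).
  by congr grade; rewrite mulrBr mulrBl mulr1 zeros_funV.
move: (part a ones_fun) (parts ones_fun e) zeros_fun zeros_funVl => p q c h.
by rewrite !mulrA -(mulrA _ (size_twist c) c) h mulr1.
Qed.

Definition on_ones (f : wfun int) : Prop := forall w, ~~ all fst w -> f w = 0.

Lemma on_onesM f g : on_ones f -> on_ones g -> on_ones (f * g).
Proof.
move=> f0 g0 w; rewrite wfunM => dw; apply: big1 => k _.
case: (boolP (all fst (take k w))) => [dt|/f0->]; last by rewrite mul0r.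
rewrite [g _]g0 ?mulr0 //; apply: contra dw => dd.
by rewrite -(cat_take_drop k w) all_cat dt.
Qed.

Lemma run_on_ones d : on_ones (run true d).
Proof.
move=> w; rewrite /run; elim: w => [|x w IH] //=; case: x.1 => //= /IH.
by case: isrun; rewrite ?andbF.
Qed.

Lemma parts_ones_fun_on_ones e : on_ones (parts ones_fun e).
Proof.
elim: e => [|a e IH]; first by rewrite /parts big_nil => -[].
rewrite /parts big_cons; apply: on_onesM; last exact: IH.
have h : on_ones ones_fun by apply: on_onesM; exact: run_on_ones.
by move=> w /h; rewrite /part => ->; rewrite if_same.
Qed.

Definition agree_ones (f g : wfun int) : Prop := forall w, all fst w -> f w = g w.

Lemma agree_onesM f f' g g' :
  agree_ones f f' -> agree_ones g g' -> agree_ones (f * g) (f' * g').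
Proof.
move=> hf hg w; rewrite !wfunM => ww; apply: eq_bigr => k _.
by move: ww; rewrite -{1}(cat_take_drop k w) all_cat => /andP[/hf-> /hg->].
Qed.

(** [zeros_fun] agrees with 1 on words of ones. This is why [rho] fixes [K al] for compositions. *)
Lemma parts_ones_fun e : agree_ones (parts ones_fun e) (parts chain_fun e).
Proof.
have c1 : agree_ones 1 zeros_fun.
  move=> [|x w] ww; first by [].
  rewrite zeros_fun_on_zeros //; by case: x ww => -[].
elim: e => [|a e IH]; first by rewrite /parts !big_nil.
rewrite /parts !big_cons; apply: agree_onesM => // w ww; rewrite /part; case: ifP => // _.
have -> : ones_fun = run true true * 1 * run true false by rewrite mulr1.
by apply: agree_onesM => //; apply: agree_onesM.
Qed.

Lemma chain_word_cat a b : chain_word (a ++ b) = chain_word a ++ chain_word b.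
Proof. by rewrite /chain_word map_cat flatten_cat. Qed.

Lemma chain_word_zeros i : chain_word (nseq i 0%N) = nseq i (false, false).
Proof. by elim: i => // i IH; rewrite /= -IH. Qed.

Lemma chain_word_ones al : all fst (chain_word al) = composition al.
Proof.
rewrite /composition; elim: al => [|[|s] al IH] //=.
rewrite -[chain_word _]/(rcons (nseq s (true, false)) (true, true) ++ chain_word al).
by rewrite in_cons /= all_cat IH all_rcons /= all_nseq orbT.
Qed.

Lemma chain_word_nil al : (chain_word al == [::]) = (al == [::]).
Proof.
by case: al => [|[|[|s]] al].
Qed.

Lemma deg_zeros i : deg (nseq i (false, false)) = 0%N.
Proof. by elim: i. Qed.

(** For i > 0 two cuts contribute, before and after the first letter: all flags are ascents, so a
    descending run has at most one letter. *)
Lemma zeros_fun_nseq i : zeros_fun (nseq i (false, false)) = 2 ^+ (i != 0%N).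
Proof.
have h0 k : run false false (nseq k (false, false)) = 1.
  by rewrite /run; elim: k => //= k; case: isrun => // _; rewrite orbT.
case: i => [|i]; first by [].
rewrite -[nseq _ _]/((false, false) :: nseq i _) /zeros_fun wfunM_cons wder_run.
rewrite !(wscaleAl, mulrDl, wscaleE, wfunD) /= (mul1r (run _ _)) h0.
by rewrite -[_ :: nseq i _]/(nseq i.+1 _) h0 ?mul0r ?mul1r ?add0r.
Qed.

Lemma deg_all1 x w : all fst (x :: w) -> deg (x :: w) != 0%N.
Proof. by case: x => -[]. Qed.

Lemma wfunM_cat (f g : wfun int) u v :
  (forall k, (k < size u)%N -> f (take k u) * g (drop k u ++ v) = 0) ->
  (forall k, (k < size v)%N -> f (u ++ take k.+1 v) * g (drop k.+1 v) = 0) ->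
  (f * g) (u ++ v) = f u * g v.
Proof.
move=> hu hv; rewrite wfunM; have ku : (size u < (size (u ++ v)).+1)%N.
  by rewrite ltnS size_cat leq_addr.
rewrite (bigD1 (Ordinal ku)) //= take_size_cat // drop_size_cat // big1 ?addr0 // => k.
rewrite -val_eqE /= take_cat drop_cat; case: ltngtP => // uk _; first exact: hu.
have kn : (k <= size u + size v)%N by rewrite -size_cat -ltnS.
have -> : (k - size u = (k - size u).-1.+1)%N by rewrite prednK // subn_gt0.
by apply: hv; move: uk kn; lia.
Qed.

Definition zero_letter : letter := (false, false).

(* A single factorization of the word contributes to the convolution. *)
Lemma sandwich i j (P : wfun int) u : on_ones P -> P [::] = 0 -> all fst u -> u != [::] ->
  (zeros_fun * P * size_twist zeros_fun) (nseq i zero_letter ++ u ++ nseq j zero_letter)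
    = zeros_fun (nseq i zero_letter) * P u * size_twist zeros_fun (nseq j zero_letter).
Proof.
move=> P1 P0 u1 une; have szc0 := size_twist_on_zeros zeros_fun_on_zeros.
have Pz w : (P * size_twist zeros_fun) (zero_letter :: w) = 0.
  by rewrite wfunM big1 // => -[[|k] kn] _ /=; rewrite ?P0 ?mul0r // P1 ?mul0r.
rewrite -mulrA wfunM_cat => [|k|k _].
- rewrite wfunM_cat ?mulrA // => k; last first.
    rewrite size_nseq => kj; rewrite P1 ?mul0r // all_cat negb_and.
    by case: j kj => //= j _; rewrite orbT.
  move=> ku; rewrite szc0 ?mulr0 // deg_cat addn_eq0 negb_and.
  have : all fst (drop k u) by move: u1; rewrite -{1}(cat_take_drop k u) all_cat => /andP[].
  have : drop k u != [::] by rewrite -size_eq0 size_drop subn_eq0 -ltnNge.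
  by case: (drop k u) => // x w _ /deg_all1->.
- rewrite size_nseq => ki; rewrite drop_nseq.
  have -> : (i - k = (i - k).-1.+1)%N by rewrite prednK // subn_gt0.
  by rewrite Pz mulr0.
rewrite zeros_fun_on_zeros ?mul0r // deg_cat deg_zeros.
by case: u u1 une => // -[[] b] u.
Qed.

(** The initial zeros go to Z and the final ones to Z^-1. Either group contributes a factor 2 if it
    is nonempty, and the final one also the sign (-1)^j. *)
Lemma limit_series_form i j al : composition al -> al != [::] ->
  word_series limit_fun (chain_word (nseq i 0%N ++ al ++ nseq j 0%N)) =
  word_series chain_fun (chain_word al) *~ ((-1) ^+ j * 2 ^+ (2 - (i == 0%N) - (j == 0%N))%N).
Proof.
move=> al1 alne; apply: funext => m; rewrite psMz /word_series parts_limit_fun.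
rewrite !chain_word_cat !chain_word_zeros; set u := chain_word al.
have u1 : all fst u by rewrite chain_word_ones.
have une : u != [::] by rewrite chain_word_nil.
(* For the empty exponent sequence [parts] is 1, so [sandwich], which asks for the value 0 at the
   empty word, does not apply. *)
case: (expts m) => [|a e].
  rewrite /parts !big_nil mulr1 zeros_funV !wfun1 (negbTE une) mul0rz.
  by case: (u) une; case: (i).
rewrite sandwich ?parts_nil //; last exact: parts_ones_fun_on_ones.
rewrite (parts_ones_fun _ u1) zeros_fun_nseq mulrzz.
rewrite /size_twist /twist /sgns size_nseq zeros_fun_nseq.
have -> : (2 - (i == 0) - (j == 0) = (i != 0) + (j != 0))%N by case: (i); case: (j).
by rewrite exprD; ring.
Qed.

Lemma chain_word_deg0 al : deg (chain_word al) = 0%N -> al = nseq (size al) 0%N.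
Proof.
elim: al => [|[|s] al IH] //; first by move=> /IH {1}->.
rewrite -[chain_word _]/(rcons (nseq s (true, false)) (true, true) ++ chain_word al) deg_cat.
by rewrite /deg -cats1 count_cat /= addn1.
Qed.

Lemma chain_word_ones_zeros al b d : chain_word al = b ++ d -> all fst b -> deg d = 0%N ->
  exists j al0, composition al0 /\ al = al0 ++ nseq j 0%N.
Proof.
elim: al b => [|[|s] al IH] b; first by exists 0%N, [::].
  case: b => [|x b]; last by case=> <-.
  rewrite cat0s => <- _ /chain_word_deg0 E; exists (size al).+1, [::]; split=> //.
pose c := rcons (nseq s (true, false)) (true, true).
rewrite -[chain_word _]/(c ++ chain_word al) => E b1 d0.
(* A cut between [b] and [d] inside the block would leave its last letter, which is weighted, in
   [d]. *)
have cb : (size c <= size b)%N.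
  rewrite leqNgt; apply/negP => bc; have : (true, true) \in d.
    have -> : d = drop (size b) c ++ chain_word al.
      have := congr1 (drop (size b)) E; rewrite drop_size_cat // drop_cat bc.
      by [].
    rewrite mem_cat; apply/orP; left; rewrite /c -cats1 drop_cat size_nseq.
    case: ltnP => [_|sb]; first by rewrite mem_cat mem_head orbT.
    have -> : (size b - s = 0)%N by move: bc sb; rewrite /c size_rcons size_nseq; lia.
    by rewrite drop0 mem_head.
  move=> tt; suff : (0 < deg d)%N by rewrite d0.
  by rewrite /deg -has_count; apply/hasP; exists (true, true).
have Eb : chain_word al = drop (size c) b ++ d.
  have := congr1 (drop (size c)) E; rewrite (drop_size_cat _ (erefl (size c))) drop_cat.
  case: ltnP => [_ -> //|bc]; have -> : size c = size b by apply/eqP; rewrite eqn_leq cb.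
  by rewrite subnn drop0 drop_size.
have [|//|j [al0 [h ->]]] := IH _ Eb.
  by move: b1; rewrite -{1}(cat_take_drop (size c) b) all_cat => /andP[].
by exists j, (s.+1 :: al0); split.
Qed.

Lemma chain_word_form al x b d :
  chain_word al = x ++ b ++ d -> deg x = 0%N -> all fst b -> deg d = 0%N ->
  exists i j al0, composition al0 /\ al = nseq i 0%N ++ al0 ++ nseq j 0%N.
Proof.
elim: al x => [|[|s] al IH] x; first by exists 0%N, 0%N, [::].
  case: x => [|y x].
    move=> E _ b1 d0; have [j [al0 h]] := @chain_word_ones_zeros _ b d E b1 d0.
    by exists 0%N, j, al0.
  case=> <- E x0 b1 d0; have [i [j [al0 [h ->]]]] := IH _ E x0 b1 d0.
  by exists i.+1, j, al0.
case: x => [|y x].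
  move=> E _ b1 d0; have [j [al0 h]] := @chain_word_ones_zeros _ b d E b1 d0.
  by exists 0%N, j, al0.
by case: s => [|s] [] <-.
Qed.

(** For a nonempty exponent sequence, a nonzero term would split the word into zeros, ones and zeros
    with a nonempty middle, and such a word only comes from the excluded shape. *)
Lemma limit_series_other al : (forall i j al0, composition al0 -> al0 <> [::] ->
    al <> nseq i 0%N ++ al0 ++ nseq j 0%N) ->
  word_series limit_fun (chain_word al) = (al == [::])%:R.
Proof.
move=> nf; apply: funext => m; rewrite /word_series parts_limit_fun.
have -> : ((al == [::])%:R : pseries) m = ((expts m == [::]) && (al == [::]))%:R.
  by case: (al == _); rewrite ?andbF // andbT expts_eq0.
case: (expts m) => [|a e]; first by rewrite /parts big_nil mulr1 zeros_funV wfun1 chain_word_nil.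
rewrite /= -mulrA wfunM big1 // => k _.
case: (eqVneq (deg (take k (chain_word al))) 0%N) => [x0|/zeros_fun_on_zeros->];
  last by rewrite mul0r.
rewrite wfunM big1 ?mulr0 // => l _.
set w := drop k (chain_word al) in l *.
case: (eqVneq (deg (drop l w)) 0%N) => [d0|/(size_twist_on_zeros zeros_fun_on_zeros)->];
  last by rewrite mulr0.
case: (boolP (all fst (take l w))) => [b1|/parts_ones_fun_on_ones->]; last by rewrite mul0r.
case: (eqVneq (take l w) [::]) => [->|bne]; first by rewrite parts_nil mul0r.
have E : chain_word al = take k (chain_word al) ++ take l w ++ drop l w by rewrite !cat_take_drop.
have [i [j [al0 [c0 alE]]]] := chain_word_form E x0 b1 d0.
case: (nf i j al0 c0 _ alE) => al0n; move: alE; rewrite al0n => alE.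
have : deg (chain_word al) = 0%N by rewrite alE /= -nseqD chain_word_zeros deg_zeros.
rewrite E !deg_cat; move: bne b1; case: (take l w) => // y b _ /deg_all1.
by case: (deg (y :: b)) => //= n _; rewrite addnC.
Qed.

(** * The projection on the span of the functions K *)

Lemma K_nil : K [::] = 1.
Proof. by rewrite K_word_series word_series_nil. Qed.

Lemma rho_form i j al : composition al -> al <> [::] ->
  rho (K (nseq i 0%N ++ al ++ nseq j 0%N)) =
  K al *~ ((-1) ^+ j * 2 ^+ (2 - (i == 0%N) - (j == 0%N))%N).
Proof.
move=> al1 /eqP ne; rewrite !K_word_series; apply: etrans (limit_series_form i j al1 ne).
by apply: rho_eq; exact: Lim_word_series.
Qed.

Lemma rho_other al :
  ~ (exists (i j : nat) (al0 : seq nat), [/\ composition al0, al0 <> [::]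
       & al = nseq i 0%N ++ al0 ++ nseq j 0%N]) -> rho (K al) = (al == [::])%:R.
Proof.
move=> nf; rewrite K_word_series; apply: etrans (limit_series_other _).
  by apply: rho_eq; exact: Lim_word_series.
by move=> i j al0 c0 n0 E; apply: nf; exists i, j, al0.
Qed.

Lemma rho_K_PQSym al : rho (K al) \in PQSym.
Proof.
have [[i [j [al0 [c0 n0 ->]]]]|/rho_other->] := pselect (exists (i j : nat) (al0 : seq nat),
    [/\ composition al0, al0 <> [::] & al = nseq i 0%N ++ al0 ++ nseq j 0%N]).
  by rewrite rho_form //; apply: zspanMz; apply: zspan_gen.
case: (al == _); last exact: zspan0.
by rewrite -[_%:R]/(1 : pseries) -K_nil; apply: zspan_gen.
Qed.

Lemma Lim_rho f : f \in WPQSym -> Lim f (rho f).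
Proof.
move: f; apply: zspan_ind => [|al _|c f g _ _ hf hg].
- by rewrite (rho_eq Lim0); exact: Lim0.
- by rewrite K_word_series (rho_eq (Lim_word_series _)); exact: Lim_word_series.
have h := LimD (LimMz c hf) hg.
by rewrite (rho_eq h).
Qed.

Lemma rho_lin c f g : f \in WPQSym -> g \in WPQSym -> rho (f *~ c + g) = rho f *~ c + rho g.
Proof. by move=> /Lim_rho hf /Lim_rho hg; apply: rho_eq; apply: LimD => //; apply: LimMz. Qed.

Lemma rho_0 : rho 0 = 0.
Proof. exact: rho_eq Lim0. Qed.

Lemma rho_PQSym f : f \in WPQSym -> rho f \in PQSym.
Proof.
move: f; apply: zspan_ind => [|al _|c f g fW gW hf hg].
- by rewrite rho_0; exact: zspan0.
- exact: rho_K_PQSym.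
by rewrite rho_lin //; exact: zspan_lin.
Qed.

Lemma rho_id f : f \in PQSym -> rho f = f.
Proof.
move: f; apply: zspan_ind => [|al alc|c f g fP gP hf hg].
- exact: rho_0.
- have [->|ne] := eqVneq al [::]; first by rewrite K_nil; exact: rho_eq Lim1.
  by rewrite -{1}[al]cats0 (rho_form 0 0 alc (elimN eqP ne)) mulr1z.
by rewrite rho_lin ?hf ?hg //; exact: PQSym_sub_WPQSym.
Qed.

(** * Prefixes and suffixes of chains *)

(** A prefix of a chain word may differ from a chain word in its last flag, to which the series are
    insensitive. *)
Definition last_blind (R : comNzRingType) (f : wfun R) : Prop :=
  forall u b d d', f (rcons u (b, d)) = f (rcons u (b, d')).

Lemma last_blindM (R : comNzRingType) (f g : wfun R) :
  last_blind f -> last_blind g -> last_blind (f * g).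
Proof.
move=> + hg u b d d'; elim: u f => [|x u IH] f hf.
  rewrite /= !wfunM_cons !wfunM_nil /wder (hf [::] b d d') (hg [::] b d d').
  by [].
rewrite !rcons_cons !wfunM_cons -!rcons_cons (hg (x :: u) b d d') (IH (wder x f)) //.
by move=> v c e e'; exact: (hf (x :: v) c e e').
Qed.

Lemma run_last_blind b0 d0 : last_blind (run b0 d0).
Proof.
move=> u b d d'; rewrite /run; congr (nat_of_bool _)%:R.
by elim: u => [|x u IH] //=; rewrite IH; case: u {IH}.
Qed.

Lemma zeros_fun_last_blind : last_blind zeros_fun.
Proof. by apply: last_blindM; exact: run_last_blind. Qed.

Lemma chain_fun_last_blind : last_blind chain_fun.
Proof.
apply: last_blindM; last exact: run_last_blind.
by apply: last_blindM; [exact: run_last_blind | exact: zeros_fun_last_blind].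
Qed.

Lemma word_series_last_blind f u b d d' : last_blind f ->
  word_series f (rcons u (b, d)) = word_series f (rcons u (b, d')).
Proof.
move=> hf; apply: funext => m; rewrite /word_series; move: (expts m) u b d d' => e.
change (last_blind (parts f e)); elim: e => [|a e IH]; rewrite /parts.
  by rewrite big_nil => u b d d'; rewrite !wfun1; case: u.
rewrite big_cons; apply: last_blindM => // u b d d'; rewrite /part (hf u b d d').
by rewrite /deg -!cats1 !count_cat; case: u.
Qed.

Lemma drop_chain_word k al : exists be, drop k (chain_word al) = chain_word be.
Proof.
elim: al k => [|a al IH] k; first by exists [::].
pose c := chain_word [:: a].
have E : chain_word (a :: al) = c ++ chain_word al by rewrite -chain_word_cat.
rewrite E drop_cat; case: ltnP => [kc|_]; last exact: IH.
case: a @c kc {E} => [|s] c kc; first by exists (0%N :: al); case: k kc.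
exists ((s - k).+1 :: al).
move: kc; rewrite /c /chain_word /= cats0 size_rcons size_nseq ltnS => ks.
by rewrite drop_rcons ?size_nseq // drop_nseq.
Qed.

(* Cutting inside a block leaves a last letter flagged as an ascent. *)
Lemma take_chain_word k al : exists be, forall f, last_blind f ->
  word_series f (take k (chain_word al)) = word_series f (chain_word be).
Proof.
suff [be [E|[u [-> E]]]] : exists be, take k (chain_word al) = chain_word be \/
    exists u, take k (chain_word al) = rcons u (true, false) /\
              chain_word be = rcons u (true, true).
- by exists be => f _; rewrite E.
- by exists be => f hf; rewrite E; exact: word_series_last_blind.
elim: al k => [|a al IH] k; first by exists [::]; left.
pose c := chain_word [:: a].
have E : chain_word (a :: al) = c ++ chain_word al by rewrite -chain_word_cat.
rewrite E take_cat; case: ltnP => [kc|_]; last first.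
  have [be [->|[u [-> Eu]]]] := IH (k - size c)%N; exists (a :: be).
    by left; rewrite /c -chain_word_cat.
  by right; exists (c ++ u); rewrite !rcons_cat -Eu /c -chain_word_cat.
case: k kc => [_|k]; first by exists [::]; left; rewrite take0.
case: a @c {E} => [|s] c; first by rewrite ltnS ltn0.
rewrite /c /chain_word /= cats0 size_rcons size_nseq ltnS => ks.
exists [:: k.+1]; right; exists (nseq k (true, false)).
rewrite -cats1 takel_cat ?size_nseq // take_nseq // /chain_word /= cats0; split=> //.
by rewrite -cats1 -[[:: (true, false)]]/(nseq 1 (true, false)) -nseqD addn1.
Qed.

Lemma word_series_take_WPQSym k al : word_series chain_fun (take k (chain_word al)) \in WPQSym.
Proof.
have [be ->] := take_chain_word k al; last exact: chain_fun_last_blind.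
by rewrite -K_word_series; exact: zspan_gen.
Qed.

Lemma word_series_drop_WPQSym k al : word_series chain_fun (drop k (chain_word al)) \in WPQSym.
Proof. by have [be ->] := drop_chain_word k al; rewrite -K_word_series; exact: zspan_gen. Qed.

(** * Compatibility with coproduct, counit and antipode *)

Lemma Delta_lin f g c : Delta (f *~ c + g) = Delta f *~ c + Delta g.
Proof.
apply: funext => pq; rewrite -[RHS]/((Delta f *~ c) pq + Delta g pq) ps2Mz.
by rewrite /Delta psDE psMz.
Qed.

Lemma tensMz f g c : tens (f *~ c) g = tens f g *~ c.
Proof. by apply: funext => pq; rewrite ps2Mz /tens psMz mulrzAl. Qed.

Lemma tens_graph0 A r : tens_graph A r 0 0.
Proof. by exists [::]; rewrite !big_nil. Qed.

(** Both word series deconcatenate along the same cuts, and the pieces stay in [WPQSym], where [rho]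
    replaces [chain_fun] by [limit_fun]. *)
Lemma rho_Delta f : f \in WPQSym -> tens_graph WPQSym rho (Delta f) (Delta (rho f)).
Proof.
move: f; apply: zspan_ind => [|al _|c f g fW gW [s [sW Ds Dr]] [t [tW Dt Drt]]].
- by rewrite rho_0 -[Delta 0]/(0 : pseries2); exact: tens_graph0.
- pose w := chain_word al.
  exists [seq (word_series chain_fun (take (val k) w), word_series chain_fun (drop (val k) w))
            | k <- index_enum 'I_(size w).+1].
  split.
  + by apply/allP => p /mapP[k _ ->]; rewrite word_series_take_WPQSym word_series_drop_WPQSym.
  + by rewrite K_word_series Delta_word_series big_map.
  rewrite K_word_series (rho_eq (Lim_word_series _)) Delta_word_series big_map.
  apply: eq_bigr => k _ /=.
  by rewrite !(rho_eq (Lim_word_series _)).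
exists ([seq (p.1 *~ c, p.2) | p <- s] ++ t); split.
- rewrite all_cat tW andbT all_map; apply/allP => p /(allP sW) /andP[p1 p2] /=.
  by rewrite zspanMz.
- rewrite Delta_lin Ds Dt big_cat big_map /= mulrz_suml; congr (_ + _).
  by apply: eq_bigr => p _; rewrite tensMz.
rewrite rho_lin // Delta_lin Dr Drt big_cat big_map /= mulrz_suml; congr (_ + _).
rewrite big_seq [RHS]big_seq; apply: eq_bigr => p /(allP sW) /andP[p1 _].
rewrite -tensMz; congr (tens _ _).
by have := rho_lin c p1 (zspan0 _ _); rewrite rho_0 !addr0.
Qed.

Lemma rho_counit f : f \in WPQSym -> counit (rho f) = counit f.
Proof.
move: f; apply: zspan_ind => [|al _|c f g fW gW hf hg]; first by rewrite rho_0.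
  by rewrite K_word_series (rho_eq (Lim_word_series _)) !counit_word_series.
by rewrite rho_lin // /counit !psDE !psMz -!/(counit _) hf hg.
Qed.

(** By [rho_eq], this limit is the value of [rho] at [S f]. *)
Lemma Lim_antipode_rho S f : is_antipode S -> f \in WPQSym -> Lim (S f) (S (rho f)).
Proof.
move=> hS; have [[_ Slin] _] := hS.
have S0 : S 0 = 0.
  have := Slin (-1) 0 0 (zspan0 _ _) (zspan0 _ _).
  by rewrite mulrN1z oppr0 addr0 mulrN1z addNr.
move: f; apply: zspan_ind => [|al _|c f g fW gW hf hg].
- by rewrite rho_0 S0; exact: Lim0.
- by rewrite K_word_series (rho_eq (Lim_word_series _)); exact: Lim_antipode.
have W h : h \in WPQSym -> rho h \in WCQSym.
  by move=> /rho_PQSym /PQSym_sub_WPQSym /WPQSym_sub_WCQSym.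
rewrite rho_lin // !Slin ?W ?(WPQSym_sub_WCQSym fW) ?(WPQSym_sub_WCQSym gW) //.
by apply: LimD => //; exact: LimMz.
Qed.

Theorem theorem4p4 : exists rho : pseries -> pseries,
  [/\ zlinear_on WPQSym PQSym rho,
      forall (i j : nat) (al0 : seq nat), composition al0 -> al0 <> [::] ->
        rho (K (nseq i 0%N ++ al0 ++ nseq j 0%N)) =
        K al0 *~ ((-1) ^+ j * 2 ^+ (2 - (i == 0%N) - (j == 0%N))%N),
      forall al : seq nat,
        ~ (exists (i j : nat) (al0 : seq nat),
             [/\ composition al0, al0 <> [::]
               & al = nseq i 0%N ++ al0 ++ nseq j 0%N]) ->
        rho (K al) = (al == [::])%:R
    & hopf_projection WPQSym PQSym rho].
Proof.
have rlin : zlinear_on WPQSym PQSym rho.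
  by split=> [f|c f g]; [exact: rho_PQSym | exact: rho_lin].
exists rho; split; [exact: rlin | exact: rho_form | exact: rho_other | split].
- split; [exact: rlin | exact: rho_eq Lim1 | | exact: rho_counit | exact: rho_Delta | ].
    by move=> f g /Lim_rho hf /Lim_rho hg; apply: rho_eq; exact: LimM.
  by move=> S hS f fW; apply: rho_eq; exact: Lim_antipode_rho.
- by move=> g gP; exists g; [exact: PQSym_sub_WPQSym | exact: rho_id].
- exact: rho_id.
Qed.
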